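(* Let $(M,\mathsf g)$ be a compact Riemannian manifold with volume form $\mu$. The Madelung transform $\Phi(\rho,\theta)=\sqrt{\rho\,e^{\mathrm i\theta}}$ is a Kähler morphism between the cotangent bundle $T^*\mathrm{Dens}(M)$ of the space of smooth probability densities, equipped with the (Sasaki-)Fisher-Rao metric, and an open subset (in the Fréchet topology of smooth functions) of the complex projective space $PC^\infty(M,\mathbb C)$ of smooth wave functions, equipped with the Fubini-Study (or Bures) metric.
   Context: $\mathrm{Dens}(M)=\{\varrho\in\Omega^n(M)\mid \varrho>0,\ \int_M\varrho=1\}$ is the space of smooth probability densities, and one writes $\varrho=\rho\mu$. The (smooth part of the) cotangent bundle is $T^*\mathrm{Dens}(M)=\mathrm{Dens}(M)\times C^\infty(M)/\mathbb R$, with elements $(\varrho,[\theta])$; it carries its canonical symplectic structure. Tangent vectors to $T^*\mathrm{Dens}(M)$ at $(\varrho,[\theta])$ are described by pairs $(\dot\varrho,\dot\theta)$ with $\dot\varrho\in\Omega^n(M)$, $\int_M\dot\varrho=0$, and $\dot\theta\in C^\infty(M)$ subject to $\int_M\dot\theta\,\varrho=0$. The Sasaki-Fisher-Rao metric on $T^*\mathrm{Dens}(M)$ is the lift of the Fisher-Rao metric $\frac14\int_M(\dot\varrho/\varrho)^2\varrho$ from $\mathrm{Dens}(M)$: $$\bar{\mathsf G}^*_{(\varrho,[\theta])}\big((\dot\varrho,\dot\theta),(\dot\varrho,\dot\theta)\big)=\frac14\int_M\Big(\Big(\frac{\dot\varrho}{\varrho}\Big)^2+\dot\theta^2\Big)\varrho.$$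 $PC^\infty(M,\mathbb C)$ is the complex projective space of smooth complex-valued functions on $M$; its elements are represented as cosets $[\psi]$ of the complex $L^2$-sphere of smooth functions, where $\psi'\in[\psi]$ if and only if $\psi'=e^{\mathrm i\alpha}\psi$ for some $\alpha\in\mathbb R$. With $\langle\cdot,\cdot\rangle$ the Hermitian $L^2$-product, the (infinite-dimensional) Fubini-Study metric is $$\mathsf G^*_\psi(\dot\psi,\dot\psi)=\frac{\langle\dot\psi,\dot\psi\rangle}{\langle\psi,\psi\rangle}-\frac{\langle\psi,\dot\psi\rangle\langle\dot\psi,\psi\rangle}{\langle\psi,\psi\rangle^2};$$ together with the complex structure of $PC^\infty(M,\mathbb C)$ it defines a Kähler structure. The Madelung transform is defined for real-valued functions $\rho>0$ and $\theta$ on $M$ by $\Phi(\rho,\theta)=\sqrt{\rho\,e^{\mathrm i\theta}}$, meaning $\sqrt\rho\,e^{\mathrm i\theta/2}$; it induces the map $(\rho\mu,[\theta])\mapsto[\sqrt{\rho\,e^{\mathrm i\theta}}]$ from $T^*\mathrm{Dens}(M)$ to $PC^\infty(M,\mathbb C)$. *)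

(* Defs.v *)
From HB Require Import structures.
From mathcomp Require Import all_boot all_order all_algebra.
From mathcomp Require Import all_classical all_reals all_analysis.
From mathcomp Require Import complex.

Set Implicit Arguments.
Unset Strict Implicit.
Unset Printing Implicit Defensive.
Import Order.TTheory GRing.Theory Num.Theory.
Import numFieldNormedType.Exports.
Local Open Scope classical_set_scope.
Local Open Scope ring_scope.
Local Open Scope complex_scope.
Local Open Scope quotient_scope.

HB.instance Definition _ (K : numDomainType) (E F : preTopologicalLmodType K) :=
  Topological.on (E * F)%type.

Section Euclidean.
Context {R : realType} {n : nat}.
Implicit Types (f : 'rV[R]_n -> R) (U : set 'rV[R]_n) (l : seq 'I_n).

Definition pderiv (l : seq 'I_n) (f : 'rV[R]_n -> R) : 'rV[R]_n -> R :=
  foldr (fun i (h : 'rV[R]_n -> R) x => 'D_(delta_mx 0 i) h x) f l.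

(* Meaningful for open U only. *)
Definition smooth_on (U : set 'rV[R]_n) (f : 'rV[R]_n -> R) : Prop :=
  forall (l : seq 'I_n) (x : 'rV[R]_n), U x ->
    {for x, continuous (pderiv l f)} /\
    forall i : 'I_n, derivable (pderiv l f) x (delta_mx 0 i).

Lemma pderiv_lincomb U (a : R) f g l : open U -> smooth_on U f ->
  smooth_on U g -> forall x, U x ->
  pderiv l (fun y => a * f y + g y) x = a * pderiv l f x + pderiv l g x.
Proof.
move=> oU sf sg; elim: l => [//|i l IH] x Ux /=.
rewrite (@near_eq_derive _ _ _ _ (a \*: pderiv l f + pderiv l g)).
  have [_ /(_ i) df] := sf l x Ux; have [_ /(_ i) dg] := sg l x Ux.
  by rewrite deriveD ?deriveZ//; exact: derivableZ.
by near=> y; apply: IH; near: y; exact: open_nbhs_nbhs.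
Unshelve. all: by end_near. Qed.

Lemma smooth_on_lincomb U (a : R) f g : open U -> smooth_on U f ->
  smooth_on U g -> smooth_on U (fun x => a * f x + g x).
Proof.
move=> oU sf sg l x Ux.
have E : {near x, a \*: pderiv l f + pderiv l g =1
                  pderiv l (fun y => a * f y + g y)}.
  near=> y; rewrite (@pderiv_lincomb U)//.
  by near: y; exact: open_nbhs_nbhs.
have [cf df] := sf l x Ux; have [cg dg] := sg l x Ux; split=> [|i].
  rewrite /prop_for /continuous_at (@pderiv_lincomb U)//.
  apply: cvg_trans (near_eq_cvg E) _.
  by apply: cvgD => //; apply: cvgMl_tmp.
apply: near_eq_derivable E _.
by apply: derivableD => //; exact: derivableZ.
Unshelve. all: by end_near. Qed.

Lemma smooth_on_cst0 U : smooth_on U (fun=> 0).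
Proof.
have E l : pderiv l (fun=> 0) = (fun=> 0) :> ('rV[R]_n -> R).
  by elim: l => //= i l ->; apply/funext => x; exact: derive_cst.
by move=> l x _; rewrite E; split=> [|i]; [exact: cst_continuous|exact: derivable_cst].
Qed.

End Euclidean.

(* The n-dimensional Lebesgue integral, as an iterated one-dimensional integral
   (they agree for nonnegative Borel functions by Tonelli's theorem). *)
Fixpoint lebesgue_int (R : realType) (n : nat) :
    ('rV[R]_n -> \bar R) -> \bar R :=
  match n with
  | 0 => fun f => f 0
  | m.+1 => fun f => (\int[@lebesgue_measure R]_t
      @lebesgue_int R m (fun y => f (row_mx (const_mx t : 'rV[R]_1) y)))%E
  end.

Record chart (R : realType) (n : nat) (M : topologicalType) := Chart {
  cdom : set M;
  cmap : M -> 'rV[R]_n;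
  cinv : 'rV[R]_n -> M;
  cdom_open : open cdom;
  cran_open : open (cmap @` cdom);
  cmapK : forall x, cdom x -> cinv (cmap x) = x;
  cmap_continuous : forall x, cdom x -> {for x, continuous cmap};
  cinv_continuous : forall y, (cmap @` cdom) y -> {for y, continuous cinv} }.

Definition cran (R : realType) n (M : topologicalType) (c : chart R n M) :
  set 'rV[R]_n := cmap c @` cdom c.

(* Without boundary. Pointed, i.e. nonempty, as the measure theory library
   requires. Second countability is not listed: it follows from compactness. *)
Record manifold (R : realType) (n : nat) := Manifold {
  carrier :> ptopologicalType;
  atlas : set (chart R n carrier);
  carrier_hausdorff : hausdorff_space carrier;
  atlas_cover : forall x, exists2 c, atlas c & cdom c x;
  atlas_smooth : forall c c', atlas c -> atlas c' -> forall i : 'I_n,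
    smooth_on (cmap c @` (cdom c `&` cdom c'))
              (fun y => cmap c' (cinv c y) 0 i) }.

(* Row i, column j: derivative in direction i of the j-th component of the
   change of coordinates from c to c'. *)
Definition transition_jacobian (R : realType) n (M : topologicalType)
    (c c' : chart R n M) (y : 'rV[R]_n) : 'M[R]_n :=
  \matrix_(i, j) pderiv [:: i] (fun z => cmap c' (cinv c z) 0 j) y.

(* gram c y is the matrix of the metric at the point of coordinates y in c. *)
Record riemannian_metric (R : realType) n (M : manifold R n) := RiemannianMetric {
  gram : chart R n M -> 'rV[R]_n -> 'M[R]_n;
  gram_smooth : forall c, atlas c -> forall i j,
    smooth_on (cran c) (fun y => gram c y i j);
  gram_sym : forall c y, atlas c -> cran c y -> (gram c y)^T = gram c y;
  gram_pos : forall c y, atlas c -> cran c y -> forall v : 'rV[R]_n, v != 0 ->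
    0 < (v *m gram c y *m v^T) 0 0;
  gram_compat : forall c c' x, atlas c -> atlas c' -> cdom c x -> cdom c' x ->
    let J := transition_jacobian c c' (cmap c x) in
    gram c (cmap c x) = J *m gram c' (cmap c' x) *m J^T }.

Definition borel (R : realType) n (M : manifold R n) : Type :=
  g_sigma_algebraType (@open M).
HB.instance Definition _ (R : realType) n (M : manifold R n) :=
  Measurable.on (borel M).

(* In every chart the volume is sqrt(det g) dx; this determines mu. *)
Definition is_riemannian_volume (R : realType) n (M : manifold R n)
    (g : riemannian_metric M) (mu : {measure set (borel M) -> \bar R}) : Prop :=
  forall c, atlas c -> forall A : set (borel M), measurable A -> A `<=` cdom c ->
    mu A = lebesgue_int
      ((fun y => (Num.sqrt (\det (gram g c y)))%:E) \_ (cmap c @` A)).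

Section SmoothFunctions.
Context {R : realType} {n : nat} (M : manifold R n).

Definition smooth (f : M -> R) : Prop :=
  forall c, atlas c -> smooth_on (cran c) (f \o cinv c).

Definition smoothb : {pred M -> R} := fun f => `[< smooth f >].

Record smoothfun := SmoothFun {
  smoothfun_val :> M -> R;
  smoothfunP : smoothb smoothfun_val }.

HB.instance Definition _ := [isSub for smoothfun_val].
HB.instance Definition _ := [Choice of smoothfun by <:].

Lemma smooth_submod_closed : submod_closed smoothb.
Proof.
split=> [|a f g /asboolP sf /asboolP sg]; apply/asboolP => c ac.
  exact: smooth_on_cst0.
exact: (smooth_on_lincomb a (@cran_open _ _ _ c) (sf c ac) (sg c ac)).
Qed.

HB.instance Definition _ := GRing.isSubmodClosed.Build R (M -> R) smoothb
  smooth_submod_closed.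
HB.instance Definition _ := [SubChoice_isSubLmodule of smoothfun by <:].

Definition compact_within (U K : set 'rV[R]_n) : Prop := compact K /\ K `<=` U.

Definition jet_space : Type :=
  prod_topology (fun i : {c : chart R n M | atlas c} * seq 'I_n =>
    {family compact_within (cran (sval i.1)), 'rV[R]_n -> R}).
HB.instance Definition _ := Topological.on jet_space.

Definition jet (f : smoothfun) : jet_space :=
  fun i => pderiv i.2 (f \o cinv (sval i.1)).

(* Uniform convergence of all partial derivatives on all compact subsets of
   all charts. *)
HB.instance Definition _ := Topological.copy smoothfun (initial_topology jet).

(* C^oo(M, C), as pairs (real part, imaginary part). *)
Definition csmoothfun : Type := (smoothfun * smoothfun)%type.
HB.instance Definition _ :=
  PreTopologicalLmodule.copy csmoothfun (smoothfun * smoothfun)%type.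

End SmoothFunctions.

Definition cval (R : realType) n (M : manifold R n) (psi : csmoothfun M)
  (x : M) : R[i] := psi.1 x +i* psi.2 x.

Definition cscale (R : realType) n (M : manifold R n) (z : R[i])
    (psi : csmoothfun M) : csmoothfun M :=
  let: x +i* y := z in (x *: psi.1 - y *: psi.2, y *: psi.1 + x *: psi.2).

Definition cis (R : realType) (t : R) : R[i] := cos t +i* sin t.

Section Calculus.
Context {R : realType}.

Definition is_dirderiv (E F : preTopologicalLmodType R) (f : E -> F)
    (p u : E) (a : F) : Prop :=
  (fun t : R => t^-1 *: (f (p + t *: u) - f p)) @ 0^' --> a.

(* Hamilton's (Michal-Bastiani) class C^k for a map defined on a relatively
   open subset U of a translate of the subspace T of E: f is continuous and, if
   0 < k, the differential U * T -> F exists and is of class C^(k-1). *)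
Fixpoint class_C (k : nat) : forall (E F : preTopologicalLmodType R)
    (T U : set E) (f : E -> F), Prop :=
  match k with
  | 0 => fun E F T U f => {within U, continuous f}
  | k'.+1 => fun E F T U f =>
      {within U, continuous f} /\
      exists df : E * E -> F,
        (forall p u, U p -> T u -> is_dirderiv f p u (df (p, u))) /\
        @class_C k' (E * E)%type F (T `*` T) (U `*` T) df
  end.

End Calculus.

Section Madelung.
Context {R : realType} {n : nat} {M : manifold R n}.
(* The volume of a compact manifold, hence finite. *)
Variable mu : {finite_measure set (borel M) -> \bar R}.

Local Notation integral f := (\int[mu]_x (f x)).

(* An n-form rho mu is represented by its density rho. *)
Definition density : Type := {rho : smoothfun M |
  `[< (forall x, 0 < rho x) /\ integral rho = 1 >]}.
HB.instance Definition _ := SubChoice.on density.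

Definition eq_mod_const (f g : smoothfun M) : bool :=
  `[< exists c : R, forall x, f x = g x + c >].

Lemma eq_mod_const_refl : reflexive eq_mod_const.
Proof. by move=> f; apply/asboolP; exists 0 => x; rewrite addr0. Qed.

Lemma eq_mod_const_sym : symmetric eq_mod_const.
Proof.
suff S f g : eq_mod_const f g -> eq_mod_const g f.
  by move=> f g; apply/idP/idP; exact: S.
move=> /asboolP[c fg]; apply/asboolP; exists (- c) => x.
by rewrite fg addrK.
Qed.

Lemma eq_mod_const_trans : transitive eq_mod_const.
Proof.
move=> g f h /asboolP[c fg] /asboolP[d gh]; apply/asboolP; exists (d + c) => x.
by rewrite fg gh addrA.
Qed.

Canonical eq_mod_const_equiv := EquivRel eq_mod_const
  eq_mod_const_refl eq_mod_const_sym eq_mod_const_trans.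

Definition smooth_mod_const : Type := {eq_quot eq_mod_const}.
HB.instance Definition _ := Choice.on smooth_mod_const.
HB.instance Definition _ := EqQuotient.on smooth_mod_const.

Definition cotangent_dens : Type := (density * smooth_mod_const)%type.

(* Linear in the first argument. *)
Definition herm (psi phi : csmoothfun M) : R[i] :=
  (\int[mu]_x complex.Re (cval psi x * conjc (cval phi x)))
  +i* (\int[mu]_x complex.Im (cval psi x * conjc (cval phi x))).

Definition sphere_sub : Type :=
  {psi : csmoothfun M | `[< herm psi psi = 1 >]}.
HB.instance Definition _ := SubChoice.on sphere_sub.

Definition sphere : Type :=
  initial_topology (val : sphere_sub -> csmoothfun M).
HB.instance Definition _ := Topological.on sphere.

Definition sphere_val (psi : sphere) : csmoothfun M := val (psi : sphere_sub).
Coercion sphere_val : sphere >-> csmoothfun.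

Definition phase_eq (psi psi' : sphere) : bool :=
  `[< exists alpha : R, forall x, cval psi x = cis alpha * cval psi' x >].

Lemma cisD (a b : R) : cis (a + b) = cis a * cis b.
Proof.
by rewrite /cis cosD sinD; apply/eqP; rewrite eq_complex /= eqxx /= addrC eqxx.
Qed.

Lemma cis0 : cis 0 = 1 :> R[i].
Proof. by rewrite /cis cos0 sin0. Qed.

Lemma phase_eq_refl : reflexive phase_eq.
Proof. by move=> f; apply/asboolP; exists 0 => x; rewrite cis0 mul1r. Qed.

Lemma phase_eq_sym : symmetric phase_eq.
Proof.
suff S f g : phase_eq f g -> phase_eq g f.
  by move=> f g; apply/idP/idP; exact: S.
move=> /asboolP[a fg]; apply/asboolP; exists (- a) => x.
by rewrite fg mulrA -cisD addNr cis0 mul1r.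
Qed.

Lemma phase_eq_trans : transitive phase_eq.
Proof.
move=> g f h /asboolP[a fg] /asboolP[b gh]; apply/asboolP; exists (a + b) => x.
by rewrite fg gh mulrA cisD.
Qed.

Canonical phase_eq_equiv := EquivRel phase_eq
  phase_eq_refl phase_eq_sym phase_eq_trans.

Definition projective : Type := {eq_quot phase_eq}.
HB.instance Definition _ :=
  Topological.copy projective (quotient_topology projective).
HB.instance Definition _ := Quotient.on projective.

Lemma projectiveP (psi psi' : sphere) :
  \pi_projective psi = \pi_projective psi' <->
  exists alpha : R, forall x, cval psi x = cis alpha * cval psi' x.
Proof.
have E : (psi == psi' %[mod {eq_quot phase_eq}]) = phase_eq psi psi'.
  by rewrite eqmodE.
split=> [h|h].
  by apply/asboolP; rewrite -[`[< _ >]]/(phase_eq psi psi') -E; exact/eqP.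
have /eqP : psi == psi' %[mod {eq_quot phase_eq}] by rewrite E; exact/asboolP.
by [].
Qed.

Definition is_madelung (Phi : cotangent_dens -> projective) : Prop :=
  forall (rho : density) (theta : smoothfun M), exists psi : sphere,
    (forall x, cval psi x = (Num.sqrt (val rho x))%:C * cis (theta x / 2)) /\
    Phi (rho, \pi_smooth_mod_const theta) = \pi_projective psi.

(* The affine chart [psi] |-> psi / <psi, chi> of the projective space, with
   domain { <psi, chi> <> 0 } and values in { z | <z, chi> = 1 }. It does not
   depend on the representative, and its inverse is z |-> [z / |z|]. These
   charts define the manifold and the complex structures of the projective
   space. *)
Definition affine_chart (chi : csmoothfun M) (q : projective) : csmoothfun M :=
  let psi : sphere := repr q in cscale (herm psi chi)^-1 psi.

Definition affine_dom (chi : csmoothfun M) : set projective :=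
  [set q : projective | herm (repr q : sphere) chi != 0].

Local Notation model := (csmoothfun M).

(* A pair (rho, theta) of real functions stands for the point (rho mu, [theta])
   of T^*Dens(M), and a pair (drho, dtheta) for the tangent vector
   (drho mu, dtheta). *)
Definition local_rep (Phi : cotangent_dens -> projective) (chi : csmoothfun M)
    (p : model) : csmoothfun M :=
  if insub p.1 : option density is Some rho
  then affine_chart chi (Phi (rho, \pi_smooth_mod_const p.2)) else 0.

Definition local_dom (Phi : cotangent_dens -> projective) (chi : csmoothfun M) :
    set model :=
  [set p | exists2 rho : density, p.1 = val rho &
    affine_dom chi (Phi (rho, \pi_smooth_mod_const p.2))].

Definition smooth_map (Phi : cotangent_dens -> projective) : Prop :=
  forall (chi : csmoothfun M) (k : nat),
    class_C k [set u : model | integral u.1 = 0] (local_dom Phi chi)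
      (local_rep Phi chi).

(* dtheta, a priori defined up to a constant, is normalized by
   int dtheta rho mu = 0. *)
Definition tangent (p : model) : set model :=
  [set u : model | integral u.1 = 0 /\ \int[mu]_x (u.2 x * p.1 x) = 0].

Definition sasaki_fisher_rao (p u v : model) : R :=
  4^-1 * \int[mu]_x (((u.1 x / p.1 x) * (v.1 x / p.1 x) + u.2 x * v.2 x)
                     * p.1 x).

Definition liouville (p u : model) : R := \int[mu]_x (p.2 x * u.1 x).

(* - d(liouville) = dq /\ dp, computed with u and v extended as constant
   (commuting) vector fields. *)
Definition canonical_symplectic (p u v : model) : R :=
  - (derive1 (fun t : R => liouville (p + t *: u) v) 0
     - derive1 (fun t : R => liouville (p + t *: v) u) 0).

(* The metric is the real part of this Hermitian form; on the diagonal it is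
   <a,a>/<z,z> - <z,a><a,z>/<z,z>^2. It is invariant under
   (z, a, b) |-> (l z, l a, l b) for l in C^* and under adding multiples of z
   to a and b, so that it may be evaluated at any nonzero representative. *)
Definition fubini_study_herm (z a b : csmoothfun M) : R[i] :=
  herm a b / herm z z - herm a z * herm z b / (herm z z) ^+ 2.

Definition fubini_study (z a b : csmoothfun M) : R :=
  complex.Re (fubini_study_herm z a b).

Definition fubini_study_form (z a b : csmoothfun M) : R :=
  fubini_study z (cscale (0 +i* 1) a) b.

(* J p is the complex structure on the tangent space at p which is determined
   by the Sasaki-Fisher-Rao metric and the canonical symplectic form. With the
   factors used in these two structures the Kaehler form G(J _, _) is one
   quarter of the canonical symplectic form. *)
Definition compatible_complex_structure (J : model -> model -> model) : Prop :=
  forall (rho : density) (theta : smoothfun M), let p := (val rho, theta) in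
  forall u, tangent p u ->
    [/\ tangent p (J p u), J p (J p u) = - u &
      forall v, tangent p v ->
        sasaki_fisher_rao p (J p u) v = 4^-1 * canonical_symplectic p u v].

(* a and b are the images of u and v under the differential of Phi, read in
   the affine chart chi. *)
Definition kahler_morphism (Phi : cotangent_dens -> projective) : Prop :=
  smooth_map Phi /\
  exists2 J, compatible_complex_structure J &
  forall (chi : csmoothfun M) (p u v : model) (a b : csmoothfun M),
    local_dom Phi chi p -> tangent p u -> tangent p v ->
    is_dirderiv (local_rep Phi chi) p u a ->
    is_dirderiv (local_rep Phi chi) p v b ->
    let z := local_rep Phi chi p in
    [/\ fubini_study z a b = sasaki_fisher_rao p u v,
        fubini_study_form z a b = 4^-1 * canonical_symplectic p u v &
        is_dirderiv (local_rep Phi chi) p (J p u) (cscale (0 +i* 1) a)].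

End Madelung.

(* Main.v *)
From HB Require Import structures.
From mathcomp Require Import all_boot all_order all_algebra.
From mathcomp Require Import all_classical all_reals all_analysis.
From mathcomp Require Import complex ring lra.
Require Import Defs.

Set Implicit Arguments.
Unset Strict Implicit.
Unset Printing Implicit Defensive.
Import Order.TTheory GRing.Theory Num.Theory.
Import numFieldNormedType.Exports.
Local Open Scope classical_set_scope.
Local Open Scope ring_scope.
Local Open Scope complex_scope.
Local Open Scope quotient_scope.

(** With psi = sqrt(rho) exp(i theta / 2), a tangent vector (drho, dtheta) is
    mapped to dpsi = psi (drho/rho + i dtheta) / 2. If int drho = 0 and
    int dtheta rho = 0 then dpsi is Hermitian orthogonal to psi, so that the
    Fubini-Study form at psi is simply
      <dpsi, dpsi'> = 1/4 int (drho/rho + i dtheta) (drho'/rho - i dtheta') rho: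
    its real part is the Sasaki-Fisher-Rao metric and its imaginary part a
    multiple of the canonical symplectic form, while multiplication by i is
    (drho, dtheta) |-> (-rho dtheta, drho/rho).

    The analysis on C^oo(M) rests on continuous convergence: h_t tends to h iff
    every partial derivative of h_t at y, in a chart, tends to that of h at x as
    h_t runs along its filter and y tends to x. Since this is a pointwise
    condition, it is stable under products and compositions as soon as the
    derivatives are polynomials in quantities that converge; this is checked on
    a syntax of differential polynomials (dexpr). *)

(** Three obstacles shape the proof. Differentiability in C^oo(M) asks all partial derivatives of a
    difference quotient to converge. For F o f with F = sqrt, cos or inverse, this brings in the
    quotients (F_k o f_t - F_k o f) / t for every derivative F_k. Hence F is carried along with all
    its derivatives, and each quotient is factored through the divided difference of F_k, which
    extends continuously to the diagonal. Points of projective space are seen only through the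
    affine charts psi / <psi, chi>. There the differential is dpsi / <psi, chi> plus a multiple of
    psi. The Fubini-Study form ignores both the rescaling and the multiple, so every chart leads
    back to the computation at psi. A wave function in the range needs a global smooth phase, which
    a zero-free function on M need not have. If psi0 is in the range and psi is close to it, psi /
    psi0 takes its values in the right half-plane, where an arctangent gives the missing phase. *)

(** * Differential polynomials and their iterated derivatives *)

Section DifferentialExpressions.
Context {R : realType} {n : nat} {J : Type}.
Implicit Types (U : set 'rV[R]_n) (l : seq 'I_n) (V : J -> 'rV[R]_n -> R).

Inductive dexpr :=
| DVar of J
| DCst of R
| DAdd of dexpr & dexpr
| DMul of dexpr & dexpr.

Fixpoint deval V (e : dexpr) : 'rV[R]_n -> R :=
  match e with
  | DVar j => V j
  | DCst c => cst c
  | DAdd a b => deval V a + deval V b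
  | DMul a b => deval V a * deval V b
  end.

Variable D : 'I_n -> J -> dexpr.

(** The summands of the product rule are ordered as in [is_deriveM], so that [is_derive_deval] holds
    by conversion. *)
Fixpoint dder (i : 'I_n) (e : dexpr) : dexpr :=
  match e with
  | DVar j => D i j
  | DCst c => DCst 0
  | DAdd a b => DAdd (dder i a) (dder i b)
  | DMul a b => DAdd (DMul a (dder i b)) (DMul b (dder i a))
  end.

(* The family V is closed under differentiation, up to polynomial expressions:
   the i-th partial derivative of V j is the expression D i j in the V's. *)
Definition diff_closed U V := forall j x, U x ->
  {for x, continuous (V j)} /\
  forall i, is_derive x (delta_mx 0 i : 'rV[R]_n) (V j) (deval V (D i j) x).

Lemma deval_continuous U V e x : diff_closed U V -> U x ->
  {for x, continuous (deval V e)}.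
Proof.
move=> sV Ux; elim: e => [j|c|a IHa b IHb|a IHa b IHb] /=.
- by have [] := sV j x Ux.
- exact: cst_continuous.
- exact: continuousD.
- exact: continuousM.
Qed.

Lemma is_derive_deval U V e i x : diff_closed U V -> U x ->
  is_derive x (delta_mx 0 i : 'rV[R]_n) (deval V e) (deval V (dder i e) x).
Proof.
move=> sV Ux; elim: e => [j|c|a IHa b IHb|a IHa b IHb] /=.
- by have [_] := sV j x Ux.
- exact: is_derive_cst.
- exact: is_deriveD.
- exact: is_deriveM.
Qed.

(** Derivatives of every order are again polynomials in the same family, so smoothness and
    convergence need only be checked on the variables. Openness of [U] is used because an outer
    derivative sees the inner one on a neighbourhood. *)
Lemma pderiv_deval U V e l x : open U -> diff_closed U V -> U x ->
  pderiv l (deval V e) x = deval V (foldr dder e l) x.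
Proof.
move=> oU sV; elim: l x => [//|i l IH] x Ux /=.
have dx : is_derive x (delta_mx 0 i : 'rV[R]_n) (deval V (foldr dder e l))
    (deval V (dder i (foldr dder e l)) x) by exact: is_derive_deval sV Ux.
rewrite (@near_eq_derive _ _ _ _ (deval V (foldr dder e l))).
  exact: derive_val.
by near=> y; apply: IH; near: y; exact: open_nbhs_nbhs.
Unshelve. all: by end_near. Qed.

Lemma smooth_on_deval U V e : open U -> diff_closed U V -> smooth_on U (deval V e).
Proof.
move=> oU sV l x Ux.
have E : {near x, deval V (foldr dder e l) =1 pderiv l (deval V e)}.
  near=> y; rewrite (@pderiv_deval U)//.
  by near: y; exact: open_nbhs_nbhs.
split=> [|i].
  rewrite /prop_for /continuous_at (@pderiv_deval U)//.
  apply: cvg_trans (near_eq_cvg E) _.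
  exact: deval_continuous sV Ux.
apply: near_eq_derivable E _.
by have [] := is_derive_deval (foldr dder e l) i sV Ux.
Unshelve. all: by end_near. Qed.

End DifferentialExpressions.

(** * Continuous convergence of all partial derivatives *)

Section ContinuousConvergence.
Context {R : realType} {n : nat}.
Implicit Types (U : set 'rV[R]_n) (l : seq 'I_n) (f : 'rV[R]_n -> R).

Lemma pderiv_eq_on U f g l x : open U -> (forall y, U y -> f y = g y) -> U x ->
  pderiv l f x = pderiv l g x.
Proof.
move=> oU fg; elim: l x => [|i l IH] x Ux /=; first exact: fg.
apply: near_eq_derive; near=> y; apply: IH; near: y; exact: open_nbhs_nbhs.
Unshelve. all: by end_near. Qed.

(* For smooth limits, this is the uniform convergence of all the derivatives on
   compact subsets of U, since 'rV[R]_n is locally compact. *)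
Definition cconv {T : Type} U (f : T -> 'rV[R]_n -> R) (F : set_system T)
    (f0 : 'rV[R]_n -> R) :=
  forall l x, U x ->
    pderiv l (f p.1) p.2 @[p --> filter_prod F (nbhs x)] --> pderiv l f0 x.

Lemma cconv_eq {T : Type} U (f g : T -> 'rV[R]_n -> R) (F : set_system T)
    (f0 g0 : 'rV[R]_n -> R) : Filter F -> open U ->
  (\forall t \near F, forall y, U y -> f t y = g t y) ->
  (forall y, U y -> f0 y = g0 y) -> cconv U f F f0 -> cconv U g F g0.
Proof.
move=> FF oU fg fg0 cf l x Ux; rewrite -(pderiv_eq_on _ oU fg0)//.
apply: cvg_trans (cf l x Ux); apply: near_eq_cvg.
exists ([set t | forall y, U y -> f t y = g t y], U).
  by split=> //; exact: open_nbhs_nbhs.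
by move=> [t y] /= [fgt Uy]; exact: pderiv_eq_on Uy.
Qed.

Lemma cconv_deval {T J : Type} (D : 'I_n -> J -> dexpr) U
    (V : T -> J -> 'rV[R]_n -> R) (F : set_system T) V0 e :
  Filter F -> open U ->
  (\forall t \near F, diff_closed D U (V t)) -> diff_closed D U V0 ->
  (forall j x, U x -> V p.1 j p.2 @[p --> filter_prod F (nbhs x)] --> V0 j x) ->
  cconv U (fun t => deval (V t) e) F (deval V0 e).
Proof.
move=> FF oU sV sV0 cV l x Ux; rewrite (pderiv_deval _ _ oU sV0)//.
have cE : deval (V p.1) (foldr (dder D) e l) p.2 @[p --> filter_prod F (nbhs x)]
    --> deval V0 (foldr (dder D) e l) x.
  elim: (foldr _ _ _) => [j|c|a IHa b IHb|a IHa b IHb] /=.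
  - exact: cV.
  - exact: cvg_cst.
  - exact: cvgD.
  - exact: cvgM.
apply: cvg_trans cE; apply: near_eq_cvg.
exists ([set t | diff_closed D U (V t)], U).
  by split=> //; exact: open_nbhs_nbhs.
by move=> [t y] /= [sVt Uy]; rewrite (pderiv_deval _ _ oU sVt).
Qed.

End ContinuousConvergence.

(** * Scalar functions with all their derivatives; divided differences *)

Section ScalarTowers.
Context {R : realType}.
Implicit Types (O : set R) (F : nat -> R -> R) (f : R -> R).

(** Keeping the whole sequence of derivatives as data makes the tower of the derivative a mere shift
    of the index. *)
Definition deriv_tower O F :=
  forall k x, O x -> is_derive x 1 (F k) (F k.+1 x).

Lemma deriv_tower_continuous O F k x : deriv_tower O F -> O x ->
  {for x, continuous (F k)}.
Proof.
move=> tF Ox; apply: differentiable_continuous.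
by apply/derivable1_diffP; have [] := tF k x Ox.
Qed.

(** Restriction to a line reduces the chain rule for [F k \o h] to the one in a single variable. *)
Lemma is_derive_line (n : nat) (h : 'rV[R]_n -> R) x v d :
  is_derive x v h d <-> is_derive (0 : R) (1 : R) (fun s => h (s *: v + x)) d.
Proof.
pose g (s : R) := h (s *: v + x).
have E : (fun t : R => t^-1 *: ((h \o shift x) (t *: v) - h x)) =
  (fun t : R => t^-1 *: ((g \o shift 0) (t *: 1) - g 0)).
  apply/funext => t /=; rewrite /g scale0r add0r addr0.
  by rewrite [t *: 1]mulr1.
have D1 : derivable h x v = derivable g 0 1 by rewrite /derivable E.
have D2 : 'D_v h x = 'D_1 g 0 by rewrite /derive E.
rewrite -/g; split=> -[dh dv]; split;
  by [rewrite -D1|rewrite -D2|rewrite D1|rewrite D2].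
Qed.

Lemma is_derive_tower_comp O F k (n : nat) (h : 'rV[R]_n -> R) x v d :
  deriv_tower O F -> O (h x) -> is_derive x v h d ->
  is_derive x v (F k \o h) (F k.+1 (h x) * d).
Proof.
move=> tF Oh /is_derive_line dh; apply/is_derive_line.
have E : h ((0 : R) *: v + x) = h x by rewrite scale0r add0r.
rewrite -E in Oh *.
have dF := tF k _ Oh.
exact: (is_derive1_comp dF dh).
Qed.

(** The divided difference, with the derivative as its value on the diagonal. This keeps [slopeE]
    valid where h_t and h coincide and is the only value compatible with [slope_cvg]. *)
Definition slope f f' (u v : R) : R :=
  if u == v then f' v else (f u - f v) / (u - v).

Lemma slopeE f f' u v : f u - f v = slope f f' u v * (u - v).
Proof.
rewrite /slope; case: eqVneq => [->|uv]; first by rewrite !subrr mulr0.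
by rewrite divfK// subr_eq0.
Qed.

(** By the mean value theorem a divided difference is a value of [f'] between the two arguments,
    hence in any ball around [w] that contains both. *)
Lemma slope_cvg O f f' w : open O -> O w ->
  (forall x, O x -> is_derive x 1 f (f' x)) -> {for w, continuous f'} ->
  slope f f' p.1 p.2 @[p --> filter_prod (nbhs w) (nbhs w)] --> f' w.
Proof.
move=> oO Ow df cf'; apply/cvgrPdist_lt => e e0.
have : \forall x \near w, O x /\ `|f' w - f' x| < e.
  near=> x; split; near: x; first exact: open_nbhs_nbhs.
  by move/cvgrPdist_lt: cf' => /(_ e e0).
move=> /nbhs_ballP[r /= r0 B].
have inB u v c : ball w r u -> ball w r v -> u <= c <= v -> ball w r c.
  rewrite /ball /= !ltr_distlC => /andP[? ?] /andP[? ?] /andP[? ?].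
  by apply/andP; split; lra.
have mvt u v : u < v -> ball w r u -> ball w r v ->
    exists2 c, ball w r c & f v - f u = f' c * (v - u).
  move=> uv Bu Bv.
  have [x xuv||c + ->] := @MVT_segment _ f f' u v (ltW uv).
  - apply: df; have [] // := B x; apply: inB Bu Bv _.
    by move: xuv; rewrite in_itv /= => /andP[/ltW -> /ltW ->].
  - apply: derivable_within_continuous => x xuv.
    have /df[] // : O x.
    by have [] // := B x; apply: inB Bu Bv _; move: xuv; rewrite in_itv.
  by rewrite in_itv /= => cuv; exists c => //; exact: inB Bu Bv cuv.
exists (ball w r, ball w r); first by split; exact: nbhsx_ballx.
move=> [u v] /= [Bu Bv]; rewrite /slope.
have [_|neq] := eqVneq u v; first by have [] := B v Bv.
have [uv|vu] := ltP u v.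
- have [c /B[_ ce] E] := mvt u v uv Bu Bv.
  by rewrite -[f u - f v]opprB E -[u - v]opprB invrN mulrNN mulfK// subr_eq0 gt_eqF.
- have {vu}uv : v < u by rewrite lt_neqAle eq_sym neq.
  have [c /B[_ ce] E] := mvt v u uv Bv Bu.
  by rewrite E mulfK// subr_eq0 gt_eqF.
Unshelve. all: by end_near. Qed.

End ScalarTowers.

(** * Products, compositions and difference quotients in coordinates *)

Section SmoothClosure.
Context {R : realType} {n : nat}.
Implicit Types (U : set 'rV[R]_n) (f g h : 'rV[R]_n -> R).

Lemma smooth_on_diff_closed U f l : smooth_on U f -> forall x, U x ->
  {for x, continuous (pderiv l f)} /\
  forall i, is_derive x (delta_mx 0 i) (pderiv l f) (pderiv (i :: l) f x).
Proof.
move=> sf x Ux; by have [cf df] := sf l x Ux; split=> // i; split.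
Qed.

Lemma smooth_on_cst U (a : R) : smooth_on U (fun=> a).
Proof.
move=> l; have : pderiv l (fun=> a) =
    cst (if l is [::] then a else 0) :> ('rV[R]_n -> R).
  elim: l => [|i l IH] //=; rewrite IH; apply/funext => x; exact: derive_cst.
by move=> -> x _; split=> [|i]; [exact: cst_continuous|exact: derivable_cst].
Qed.

Lemma cconv_cst {T} (F : set_system T) U f : Filter F -> smooth_on U f ->
  cconv U (fun=> f) F f.
Proof.
move=> FF sf l x Ux; have [cf _] := sf l x Ux.
exact: (@cvg_comp _ _ _ snd (pderiv l f) _ _ _ (@cvg_snd _ _ F _ _) cf).
Qed.

Lemma cconv_val {T} (F : set_system T) U (fs : T -> 'rV[R]_n -> R) f x :
  cconv U fs F f -> U x -> fs p.1 p.2 @[p --> filter_prod F (nbhs x)] --> f x.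
Proof. by move=> /(_ [::] x). Qed.

Definition mul_vars f g (j : bool * seq 'I_n) :=
  pderiv j.2 (if j.1 then f else g).

Definition mul_vars_der (i : 'I_n) (j : bool * seq 'I_n) : @dexpr R _ :=
  DVar (j.1, i :: j.2).

Let mul_vars_closed U f g : smooth_on U f -> smooth_on U g ->
  diff_closed mul_vars_der U (mul_vars f g).
Proof. by move=> sf sg [[] l] x Ux; exact: smooth_on_diff_closed Ux. Qed.

Let mulE f g : (fun x => f x * g x) =
  deval (mul_vars f g) (DMul (DVar (true, [::])) (DVar (false, [::]))).
Proof. by []. Qed.

Lemma smooth_onM U f g : open U -> smooth_on U f -> smooth_on U g ->
  smooth_on U (fun x => f x * g x).
Proof.
by move=> oU sf sg; rewrite mulE; apply: smooth_on_deval oU (mul_vars_closed _ _).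
Qed.

Let mul_vars_cvg {T} (F : set_system T) U (fs gs : T -> 'rV[R]_n -> R) f g :
  cconv U fs F f -> cconv U gs F g -> forall j x, U x ->
  mul_vars (fs p.1) (gs p.1) j p.2 @[p --> filter_prod F (nbhs x)] -->
    mul_vars f g j x.
Proof. by move=> cf cg [[] l] x Ux; [exact: cf|exact: cg]. Qed.

Lemma cconvM {T} (F : set_system T) U (fs gs : T -> 'rV[R]_n -> R) f g :
  Filter F -> open U ->
  (forall t, smooth_on U (fs t)) -> (forall t, smooth_on U (gs t)) ->
  smooth_on U f -> smooth_on U g ->
  cconv U fs F f -> cconv U gs F g ->
  cconv U (fun t x => fs t x * gs t x) F (fun x => f x * g x).
Proof.
move=> FF oU sfs sgs sf sg cf cg; rewrite mulE.
apply: (@cconv_deval _ _ _ _ mul_vars_der _ (fun t => mul_vars (fs t) (gs t))) => //.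
- by apply/nearW => t; exact: (mul_vars_closed (sfs t) (sgs t)).
- exact: mul_vars_closed.
- exact: mul_vars_cvg.
Qed.

Lemma cconvD {T} (F : set_system T) U (fs gs : T -> 'rV[R]_n -> R) f g :
  Filter F -> open U ->
  (forall t, smooth_on U (fs t)) -> (forall t, smooth_on U (gs t)) ->
  smooth_on U f -> smooth_on U g ->
  cconv U fs F f -> cconv U gs F g ->
  cconv U (fun t x => fs t x + gs t x) F (fun x => f x + g x).
Proof.
move=> FF oU sfs sgs sf sg cf cg.
have E f' g' : (fun x => f' x + g' x) =
  deval (mul_vars f' g') (DAdd (DVar (true, [::])) (DVar (false, [::]))) by [].
rewrite E; apply: (@cconv_deval _ _ _ _ mul_vars_der _
  (fun t => mul_vars (fs t) (gs t)) _ _ (DAdd _ _)) => //.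
- by apply/nearW => t; exact: (mul_vars_closed (sfs t) (sgs t)).
- exact: mul_vars_closed.
- exact: mul_vars_cvg.
Qed.

(* The Q_k stand for the quotients (F_k \o h - F_k \o h0) / t, with
   q = (h - h0) / t; then d Q_k = (F_(k+1) \o h) dq + Q_(k+1) dh0. *)
Inductive comp_var :=
| CVh of seq 'I_n | CVh0 of seq 'I_n | CVq of seq 'I_n | CVF of nat | CVQ of nat.

Definition comp_vars (F : nat -> R -> R) h h0 q (Q : nat -> 'rV[R]_n -> R)
    (j : comp_var) :=
  match j with
  | CVh l => pderiv l h
  | CVh0 l => pderiv l h0
  | CVq l => pderiv l q
  | CVF k => F k \o h
  | CVQ k => Q k
  end.

Definition comp_vars_der (i : 'I_n) (j : comp_var) : @dexpr R _ :=
  match j with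
  | CVh l => DVar (CVh (i :: l))
  | CVh0 l => DVar (CVh0 (i :: l))
  | CVq l => DVar (CVq (i :: l))
  | CVF k => DMul (DVar (CVF k.+1)) (DVar (CVh [:: i]))
  | CVQ k => DAdd (DMul (DVar (CVF k.+1)) (DVar (CVq [:: i])))
                  (DMul (DVar (CVQ k.+1)) (DVar (CVh0 [:: i])))
  end.

Variables (O : set R) (F : nat -> R -> R).
Hypotheses (oO : open O) (tF : deriv_tower O F).

Lemma comp_vars_closed U h h0 q (Q : nat -> 'rV[R]_n -> R) :
  smooth_on U h -> smooth_on U h0 -> smooth_on U q ->
  (forall x, U x -> O (h x)) ->
  (forall k x, U x -> {for x, continuous (Q k)} /\ forall i,
     is_derive x (delta_mx 0 i) (Q k)
       (F k.+1 (h x) * pderiv [:: i] q x + Q k.+1 x * pderiv [:: i] h0 x)) ->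
  diff_closed comp_vars_der U (comp_vars F h h0 q Q).
Proof.
move=> sh sh0 sq Oh cQ [l|l|l|k|k] x Ux; [exact: smooth_on_diff_closed Ux..| |].
- have [ch dh] := smooth_on_diff_closed [::] sh Ux; split=> [|i].
    exact: (@continuous_comp _ _ _ h (F k) x ch
      (deriv_tower_continuous (k:=k) tF (Oh x Ux))).
  have D := is_derive_tower_comp k tF (Oh x Ux) (dh i); exact: D.
- exact: cQ.
Qed.

(** With q = 0 and Q = 0 the rule for the derivative of Q_k reads 0 = 0, so the variables made for
    quotients also serve plain compositions. *)
Lemma comp_vars_closed0 U h : smooth_on U h -> (forall x, U x -> O (h x)) ->
  diff_closed comp_vars_der U (comp_vars F h h (fun=> 0) (fun _ _ => 0)).
Proof.
move=> sh Oh.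
apply: (comp_vars_closed sh sh (@smooth_on_cst U 0) Oh) => k x Ux.
split=> [|i]; first exact: cst_continuous.
have -> : pderiv [:: i] (fun=> 0) x = 0 :> R by rewrite /= derive_cst.
by rewrite mulr0 mul0r addr0; exact: is_derive_cst.
Qed.

Lemma smooth_on_comp U h : open U -> smooth_on U h ->
  (forall x, U x -> O (h x)) -> smooth_on U (F 0 \o h).
Proof.
move=> oU sh Oh.
exact: (smooth_on_deval (DVar (CVF 0)) oU (comp_vars_closed0 sh Oh)).
Qed.

Lemma cvg_tower_comp {T} (G : set_system T) U (hs : T -> 'rV[R]_n -> R) h k x :
  Filter G -> cconv U hs G h -> U x -> O (h x) ->
  (F k \o hs p.1) p.2 @[p --> filter_prod G (nbhs x)] --> F k (h x).
Proof.
move=> FG ch Ux Oh.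
apply: (@cvg_comp _ _ _ (fun p => hs p.1 p.2) (F k) _ (nbhs (h x))).
  exact: cconv_val Ux.
exact: (deriv_tower_continuous tF).
Qed.

Lemma cconv_comp {T} (G : set_system T) U (hs : T -> 'rV[R]_n -> R) h :
  Filter G -> open U -> (forall t, smooth_on U (hs t)) -> smooth_on U h ->
  (\forall t \near G, forall x, U x -> O (hs t x)) ->
  (forall x, U x -> O (h x)) -> cconv U hs G h ->
  cconv U (fun t => F 0 \o hs t) G (F 0 \o h).
Proof.
move=> FG oU shs sh Ohs Oh ch.
apply: (@cconv_deval _ _ _ _ comp_vars_der _
  (fun t => comp_vars F (hs t) (hs t) (fun=> 0) (fun _ _ => 0)) _
  (comp_vars F h h (fun=> 0) (fun _ _ => 0)) (DVar (CVF 0))) => //.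
- by apply: filterS Ohs => t Oht; exact: comp_vars_closed0.
- exact: comp_vars_closed0.
- move=> [l|l|l|k|k] x Ux; [exact: ch..| | |].
  + by apply: (cconv_cst _ (@smooth_on_cst U 0)).
  + have D := cvg_tower_comp (k:=k) FG ch Ux (Oh x Ux); exact: D.
  + exact: cvg_cst.
Qed.

(** The quotient is the single variable Q_0 of a closed family, so it suffices that every Q_k
    converges; no higher-order chain rule is written out. *)
Lemma cconv_comp_quotient {T} (G : set_system T) U (hs qs : T -> 'rV[R]_n -> R)
    h a (tau : T -> R) : Filter G -> open U ->
  (forall t, smooth_on U (hs t)) -> smooth_on U h ->
  (forall t, smooth_on U (qs t)) -> smooth_on U a ->
  (\forall t \near G, forall x, U x -> O (hs t x)) ->
  (forall x, U x -> O (h x)) ->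
  (forall t x, U x -> qs t x = (tau t)^-1 * (hs t x - h x)) ->
  cconv U hs G h -> cconv U qs G a ->
  cconv U (fun t x => (tau t)^-1 * (F 0 (hs t x) - F 0 (h x))) G
    (fun x => F 1 (h x) * a x).
Proof.
move=> FG oU shs sh sqs sa Ohs Oh qE ch cq.
pose Qs t k x := (tau t)^-1 * (F k (hs t x) - F k (h x)).
pose Q k x := F k.+1 (h x) * a x.
apply: (@cconv_deval _ _ _ _ comp_vars_der _
  (fun t => comp_vars F (hs t) h (qs t) (Qs t)) _
  (comp_vars F h h a Q) (DVar (CVQ 0))) => //.
- apply: filterS Ohs => t Oht.
  apply: (comp_vars_closed (shs t) sh (sqs t) Oht) => k x Ux.
  have Cht := deriv_tower_continuous (k:=k) tF (Oht x Ux).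
  have Ch := deriv_tower_continuous (k:=k) tF (Oh x Ux).
  have [cht dht] := smooth_on_diff_closed [::] (shs t) Ux.
  have [ch0 dh] := smooth_on_diff_closed [::] sh Ux.
  split=> [|i].
    rewrite /Qs; apply: (@continuousM _ _ (cst _)); first exact: cst_continuous.
    by apply: (@continuousB _ _ _ (F k \o hs t) (F k \o h)); exact: continuous_comp.
  have qt : pderiv [:: i] (qs t) x =
      (tau t)^-1 * (pderiv [:: i] (hs t) x - pderiv [:: i] h x).
    rewrite (pderiv_eq_on _ oU (qE t) Ux).
    have D : is_derive x (delta_mx 0 i) ((tau t)^-1 \*: (hs t - h))
        ((tau t)^-1 *: (pderiv [:: i] (hs t) x - pderiv [:: i] h x)).
      by apply: is_deriveZ; apply: is_deriveB.
    by case: D => _ D2; exact: D2.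
  rewrite qt; have D : is_derive x (delta_mx 0 i)
      ((tau t)^-1 \*: ((F k \o hs t) - (F k \o h)))
      ((tau t)^-1 *: (F k.+1 (hs t x) * pderiv [:: i] (hs t) x -
                      F k.+1 (h x) * pderiv [:: i] h x)).
    apply: is_deriveZ; apply: is_deriveB.
      exact: (is_derive_tower_comp k tF (Oht x Ux) (dht i)).
    exact: (is_derive_tower_comp k tF (Oh x Ux) (dh i)).
  apply: is_derive_eq D _; rewrite /Qs /=; set s := (tau t)^-1.
  rewrite [LHS]/GRing.scale/=; ring.
- apply: (comp_vars_closed sh sh sa Oh) => k x Ux.
  have Ch := deriv_tower_continuous (k:=k.+1) tF (Oh x Ux).
  have [ch0 dh] := smooth_on_diff_closed [::] sh Ux.
  have [ca da] := smooth_on_diff_closed [::] sa Ux.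
  split=> [|i].
    by apply: (@continuousM _ _ (F k.+1 \o h)) => //; exact: continuous_comp.
  have D : is_derive x (delta_mx 0 i) ((F k.+1 \o h) * a)
      (F k.+1 (h x) *: pderiv [:: i] a x +
       a x *: (F k.+2 (h x) * pderiv [:: i] h x)).
    by apply: is_deriveM (da i); exact: (is_derive_tower_comp k.+1 tF (Oh x Ux) (dh i)).
  by apply: is_derive_eq D _; rewrite /Q /GRing.scale/=; ring.
- move=> [l|l|l|k|k] x Ux; [exact: ch| |exact: cq| | ].
  + exact: (cconv_cst _ sh).
  + have D := cvg_tower_comp (k:=k) FG ch Ux (Oh x Ux); exact: D.
  (* [slopeE] splits Q_k into the divided difference of [F k], whose two arguments both tend to
     [h x], and the quotient q, which tends to [a]. *)
  + have -> : (fun p : T * 'rV_n =>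
          comp_vars F (hs p.1) h (qs p.1) (Qs p.1) (CVQ k) p.2)
       = (fun p => slope (F k) (F k.+1) (hs p.1 p.2) (h p.2) *
                   ((tau p.1)^-1 * (hs p.1 p.2 - h p.2))).
      by apply/funext => p; rewrite /= /Qs (slopeE _ (F k.+1)) mulrCA.
    apply: cvgM.
      have H := cvg_pair (cconv_val ch Ux) (cconv_val (cconv_cst FG sh) Ux).
      have S := slope_cvg oO (Oh x Ux) (tF k)
        (deriv_tower_continuous (k:=k.+1) tF (Oh x Ux)).
      exact: (@cvg_comp _ _ _ (fun p : T * 'rV_n => (hs p.1 p.2, h p.2))
        (fun p => slope (F k) (F k.+1) p.1 p.2) _
        (filter_prod (nbhs (h x)) (nbhs (h x))) _ (H _ _ _) S).
    apply: cvg_trans (cconv_val cq Ux); apply: near_eq_cvg.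
    exists (setT, U); first by split; [exact: filterT|exact: open_nbhs_nbhs].
    by move=> [t y] /= [_ Uy]; rewrite qE.
Qed.

End SmoothClosure.

(** * Limits in initial, product and uniform topologies *)

Section Topologies.

Lemma cvg_initialP (S : choiceType) (T : topologicalType) (g : S -> T) {I : Type}
    (F : set_system I) (hs : I -> S) (s : S) : Filter F ->
  hs @ F --> (s : initial_topology g) <-> g (hs i) @[i --> F] --> g s.
Proof.
move=> FF; split=> [hs_s|ghs_gs].
  exact: (@cvg_comp _ _ _ hs (g : initial_topology g -> T) _
    (nbhs (s : initial_topology g)) _ hs_s (@initial_continuous _ _ g s)).
move=> A /= [_ [[B oB <-] Bs sBA]].
have : nbhs (g s) B by apply: open_nbhs_nbhs.
move=> /ghs_gs FB.
exact: (@filterS _ F FF (fun i => B (g (hs i))) (fun i => A (hs i))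
  (fun i => @sBA (hs i)) FB).
Qed.

Lemma cvg_prodP (K : Type) (V : K -> topologicalType) {I : Type}
    (F : set_system I) (hs : I -> prod_topology V) (s : prod_topology V) :
  Filter F -> hs @ F --> s <-> forall k, hs i k @[i --> F] --> s k.
Proof.
move=> FF; split=> [/cvg_sup hs_s k|hs_s].
  have /(_ k) := hs_s; have := @cvg_initialP _ (V k) (fun f => f k) I F hs s FF.
  by case.
apply/cvg_sup => k.
have := @cvg_initialP _ (V k) (fun f => f k) I F hs s FF.
by case=> _; apply; exact: hs_s.
Qed.

Lemma cvg_uniformP (R : realType) (U : choiceType) (A : set U) {I : Type}
    (F : set_system I) (hs : I -> U -> R) (h : U -> R) : Filter F ->
  {uniform A, hs @ F --> h} <->
  forall e, 0 < e -> \forall i \near F, forall y, A y -> `|h y - hs i y| < e.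
Proof.
move=> FF; split=> [hs_h e e0|hs_h P /uniform_nbhs[E [entE sEP]]].
  apply: (hs_h [set k | forall y, A y -> `|h y - k y| < e]); apply/uniform_nbhs.
  by exists [set xy | ball xy.1 e xy.2]; split; [exact: entourage_ball (PosNum e0)|].
have [e e0 sE] : filter_from [set e : R | 0 < e]
    (fun e => [set xy : R * R | ball xy.1 e xy.2]) E by rewrite entourage_from_ballE.
apply: filterS (hs_h e e0) => i hi; apply: sEP => y Ay; apply: sE; exact: hi.
Qed.

Lemma closed_ball_compact (R : realType) n (x : 'rV[R]_n) (r : R) : 0 < r ->
  compact (closed_ball x r).
Proof.
move=> r0; apply: bounded_closed_compact; last exact: closed_ball_closed.
exists (`|x| + r); split=> [|e xe y]; first exact: num_real.
rewrite closed_ballE// /closed_ball_ /= => xy; apply: le_trans (ltW xe).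
by rewrite -lerBlDl (le_trans (lerB_dist _ _))// distrC.
Qed.

End Topologies.

(** * The topology of smooth functions as continuous convergence *)

Section SmoothTopology.
Context {R : realType} {n : nat} {M : manifold R n}.

Lemma smooth_on_chart (f : smoothfun M) c : atlas c ->
  smooth_on (cran c) (f \o cinv c).
Proof. by have /asboolP := smoothfunP f; apply. Qed.

Lemma smoothfunE (f g : smoothfun M) : (forall x, f x = g x) -> f = g.
Proof. by move=> fg; apply/val_inj/funext. Qed.

Lemma cran_nbhs (c : chart R n M) x : cran c x -> nbhs x (cran c).
Proof. by move=> cx; apply: open_nbhs_nbhs; split=> //; exact: cran_open. Qed.

(** In one direction a closed ball inside the chart is a compact neighbourhood, and uniform
    convergence on it combines with continuity of the limit derivative. In the other, the local
    estimates are patched over a compact set. *)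
Lemma cvg_smoothP {T : Type} (F : set_system T) (hs : T -> smoothfun M)
    (h : smoothfun M) : Filter F ->
  hs @ F --> h <->
  forall c, atlas c -> cconv (cran c) (fun t => hs t \o cinv c) F (h \o cinv c).
Proof.
move=> FF.
have cvg_jet : hs @ F --> h <-> forall i, jet (hs t) i @[t --> F] --> jet h i.
  have := @cvg_initialP _ (jet_space M) (@jet R n M) T F hs h FF.
  rewrite /jet_space => -[A B].
  by split=> [/A/cvg_prodP//|H]; apply: B; apply/cvg_prodP.
split=> [/cvg_jet hs_h c ac l x cx|H].
  have [r rc] := (nbhs_closedballP _ _).1 (cran_nbhs cx).
  have K : compact_within (cran c) (closed_ball x r%:num).
    by split=> //; exact: closed_ball_compact.
  have /fam_cvgP/(_ _ K)/cvg_uniformP U := hs_h (exist _ c ac, l).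
  have [ch _] := smooth_on_chart h ac l cx.
  apply/cvgrPdist_lt => e e0.
  exists ([set t | forall y, closed_ball x r%:num y ->
            `|pderiv l (h \o cinv c) y - pderiv l (hs t \o cinv c) y| < e / 2],
          [set y | closed_ball x r%:num y /\
            `|pderiv l (h \o cinv c) x - pderiv l (h \o cinv c) y| < e / 2]).
    split=> /=; first by apply: U; rewrite divr_gt0.
    apply: (@filterI _ (nbhs x)); first by apply/nbhs_closedballP; exists r.
    by move/cvgrPdist_lt: ch; apply; rewrite divr_gt0.
  move=> [t y] /= [hst [ry hxy]].
  by rewrite (splitr e) (le_lt_trans (ler_distD (pderiv l (h \o cinv c) y) _ _))//
    ltrD// hst.
apply/cvg_jet => -[[c ac] l]; apply/fam_cvgP => K [cK Kc]; apply/cvg_uniformP => e e0.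
(* In its near-covering form, compactness turns estimates near each point into one member of [F]
   that works on all of [K]. *)
have /= := (compact_near_coveringP K).1 cK T F
  (fun t y => `|pderiv l (h \o cinv c) y - pderiv l (hs t \o cinv c) y| < e) FF.
apply=> x Kx.
have [ch _] := smooth_on_chart h ac l (Kc _ Kx).
have [[A B] /= [FA xB] AB] : \forall p \near filter_prod F (nbhs x),
    `|pderiv l (h \o cinv c) x - pderiv l (hs p.1 \o cinv c) p.2| < e / 2.
  by move/cvgrPdist_lt: (H c ac l x (Kc _ Kx)); apply; rewrite divr_gt0.
exists (B `&` [set y |
  `|pderiv l (h \o cinv c) x - pderiv l (h \o cinv c) y| < e / 2], A).
  split=> //=; apply: filterI => //.
  by move/cvgrPdist_lt: ch; apply; rewrite divr_gt0.
move=> [y t] /= [[By hxy] At].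
rewrite (splitr e) (le_lt_trans (ler_distD (pderiv l (h \o cinv c) x) _ _))//.
by apply: ltrD; [rewrite distrC|exact: (AB (t, y) (conj At By))].
Unshelve. all: by end_near. Qed.

End SmoothTopology.

(** * Algebra and superposition on smooth functions *)

HB.lock Definition smul (R : realType) n (M : manifold R n) (f g : smoothfun M)
  : smoothfun M := insubd (0 : smoothfun M) (fun x => f x * g x).
HB.lock Definition scst (R : realType) n (M : manifold R n) (a : R)
  : smoothfun M := insubd (0 : smoothfun M) (fun=> a).
(* Zero if phi \o f is not smooth. *)
HB.lock Definition scomp (R : realType) n (M : manifold R n) (phi : R -> R)
  (f : smoothfun M) : smoothfun M := insubd (0 : smoothfun M) (phi \o f).

Section SmoothOperations.
Context {R : realType} {n : nat} {M : manifold R n}.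
Implicit Types (f g h : smoothfun M) (O : set R) (F : nat -> R -> R).

Lemma saddE f g x : (f + g) x = f x + g x.
Proof. by []. Qed.

Lemma soppE f x : (- f) x = - f x.
Proof. by []. Qed.

Lemma sscaleE (a : R) f x : (a *: f) x = a * f x.
Proof. by []. Qed.

Lemma s0E x : (0 : smoothfun M) x = 0.
Proof. by []. Qed.

Lemma insubd_smoothE (phi : M -> R) x : smooth phi ->
  (insubd (0 : smoothfun M) phi) x = phi x.
Proof. by move=> sphi; rewrite [smoothfun_val _]insubdK//; exact/asboolP. Qed.

(** The product is smooth in every chart, so the default 0 of [insubd] is never taken. *)
Lemma smulE f g x : smul f g x = f x * g x.
Proof.
rewrite smul.unlock insubd_smoothE// => c ac.
exact: (smooth_onM (@cran_open _ _ _ c) (smooth_on_chart f ac)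
  (smooth_on_chart g ac)).
Qed.

Lemma scstE a x : scst M a x = a.
Proof. by rewrite scst.unlock insubd_smoothE// => c _; exact: smooth_on_cst. Qed.

Lemma scompE O F f x : deriv_tower O F -> (forall x, O (f x)) ->
  scomp (F 0) f x = F 0 (f x).
Proof.
move=> tF Of; rewrite scomp.unlock insubd_smoothE// => c ac.
exact: (smooth_on_comp tF (@cran_open _ _ _ c) (smooth_on_chart f ac)
  (fun y _ => Of _)).
Qed.

Lemma smulC f g : smul f g = smul g f.
Proof. by apply: smoothfunE => x; rewrite !smulE mulrC. Qed.

Section Convergence.
Context {T : Type} {F : set_system T} {FF : Filter F}.
Implicit Types (fs gs hs : T -> smoothfun M).

Lemma cvg_sadd fs gs f g : fs @ F --> f -> gs @ F --> g ->
  fs t + gs t @[t --> F] --> f + g.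
Proof.
move=> /cvg_smoothP cf /cvg_smoothP cg; apply/cvg_smoothP => c ac.
by apply: (cconvD FF (@cran_open _ _ _ c)) (cf c ac) (cg c ac) => *;
  exact: smooth_on_chart.
Qed.

Lemma cvg_smul fs gs f g : fs @ F --> f -> gs @ F --> g ->
  smul (fs t) (gs t) @[t --> F] --> smul f g.
Proof.
move=> /cvg_smoothP cf /cvg_smoothP cg; apply/cvg_smoothP => c ac.
apply: cconv_eq (cconvM FF _ _ _ _ _ (cf c ac) (cg c ac)); try exact: cran_open.
- by apply: nearW => t y _ /=; rewrite smulE.
- by move=> y _ /=; rewrite smulE.
- by move=> t; exact: smooth_on_chart.
- by move=> t; exact: smooth_on_chart.
- exact: smooth_on_chart.
- exact: smooth_on_chart.
Qed.

Lemma cvg_scst (a : T -> R) a0 : a @ F --> a0 ->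
  scst M (a t) @[t --> F] --> scst M a0.
Proof.
move=> ca; apply/cvg_smoothP => c ac l x cx.
have E b : pderiv l (scst M b \o cinv c) = cst (if l is [::] then b else 0).
  have -> : scst M b \o cinv c = cst b by apply/funext => y /=; rewrite scstE.
  elim: l => [|i l IH] //=; rewrite IH; apply/funext => y.
  by rewrite /=; exact: derive_cst.
under eq_fun do rewrite E; rewrite E.
case: l {E} => [|_ _]; last exact: cvg_cst.
exact: (@cvg_comp _ _ _ fst a _ F _ (@cvg_fst _ _ _ _ _) ca).
Qed.

(** Joint continuity of scaling in the scalar and the function thus follows from that of the
    product. *)
Lemma sscale_smul (a : R) f : a *: f = smul (scst M a) f.
Proof. by apply: smoothfunE => x; rewrite smulE scstE. Qed.

Lemma cvg_sscale (a : T -> R) (a0 : R) fs f : a @ F --> a0 -> fs @ F --> f ->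
  a t *: fs t @[t --> F] --> a0 *: f.
Proof.
move=> ca cf; under eq_fun do rewrite sscale_smul; rewrite sscale_smul.
exact: (cvg_smul (cvg_scst ca) cf).
Qed.

Lemma cvg_sopp fs f : fs @ F --> f -> - fs t @[t --> F] --> - f.
Proof.
move=> cf; under eq_fun do rewrite -scaleN1r; rewrite -scaleN1r.
by apply: cvg_sscale cf; exact: cvg_cst.
Qed.

Lemma cvg_ssub fs gs f g : fs @ F --> f -> gs @ F --> g ->
  fs t - gs t @[t --> F] --> f - g.
Proof. by move=> cf cg; apply: cvg_sadd cf (cvg_sopp cg). Qed.

(** Continuous convergence without derivatives, carried from a chart around [x] back to [M]. *)
Lemma cvg_near_eval fs f x : fs @ F --> f ->
  fs p.1 p.2 @[p --> filter_prod F (nbhs x)] --> f x.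
Proof.
move=> /cvg_smoothP cf; have [c ac cx] := atlas_cover x.
have ccx : cran c (cmap c x) by exists x.

move=> P; rewrite -{1}(cmapK cx) => /(cf c ac [::] _ ccx).
move=> [[A' B'] /= [FA' xB'] AB'].
exists (A', cdom c `&` cmap c @^-1` B').
  split=> //=; apply: filterI.
    by apply: open_nbhs_nbhs; split=> //; exact: cdom_open.
  exact: (cmap_continuous cx).
move=> [t y] /= [A't [cy B'y]]; have := AB' (t, cmap c y) (conj A't B'y).
by rewrite /= cmapK.
Qed.

Lemma cvg_eval fs f x : fs @ F --> f -> fs t x @[t --> F] --> f x.
Proof.
move=> /(@cvg_near_eval _ _ x) cf P /cf[[A B] /= [FA xB] AB].
have Bx : B x := nbhs_singleton xB.
exact: (@filterS _ F FF A _ (fun t At => AB (t, x) (conj At Bx)) FA).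
Qed.

Hypothesis Mcompact : compact [set: M].

(** Compactness of [M] makes an open condition on values stable in the function. It keeps perturbed
    densities positive and perturbed wave functions in a half-plane relative to the original one. *)
Lemma cvg_near_open fs f O : open O -> fs @ F --> f -> (forall x, O (f x)) ->
  \forall t \near F, forall x, O (fs t x).
Proof.
move=> oO cf Of.
have := (compact_near_coveringP _).1 Mcompact T F (fun t x => O (fs t x)) FF.
have H x : [set: M] x -> \forall x' \near x & t \near F, O (fs t x').
  move=> _.
  have [[A B] /= [FA xB] AB] : (fs p.1 p.2 @[p --> filter_prod F (nbhs x)]) O.
    exact: (@cvg_near_eval _ _ x cf O (open_nbhs_nbhs (conj oO (Of x)))).
  by exists (B, A) => // -[y t] /= [By At]; exact: (AB (t, y)).
by move=> /(_ H); apply: filterS => t Ot x; exact: Ot.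
Qed.

Lemma cvg_uniform fs f (e : R) : fs @ F --> f -> 0 < e ->
  \forall t \near F, forall x, `|f x - fs t x| < e.
Proof.
move=> cf e0.
have cg : f - fs t @[t --> F] --> f - f by apply: cvg_ssub cf; exact: cvg_cst.
have B0 (x : M) : ball (0 : R) e ((f - f) x) by rewrite subrr; exact: ballxx.
have := cvg_near_open (ball_open (0 : R) e) cg B0; apply: filterS => t B x.
by have := B x; rewrite /ball /= sub0r normrN.
Qed.

Lemma cvg_scomp O G fs f : open O -> deriv_tower O G -> fs @ F --> f ->
  (forall x, O (f x)) -> scomp (G 0) (fs t) @[t --> F] --> scomp (G 0) f.
Proof.
move=> oO tG cf Of; have Ofs := cvg_near_open oO cf Of.
apply/cvg_smoothP => c ac; move/cvg_smoothP/(_ c ac) : cf => cf.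
have cG : cconv (cran c) (fun t => G 0 \o (fs t \o cinv c)) F (G 0 \o (f \o cinv c)).
  apply: (cconv_comp tG FF _ _ _ _ _ cf); first exact: cran_open.
  - by move=> t; exact: smooth_on_chart.
  - exact: smooth_on_chart.
  - by apply: filterS Ofs => t Ot y _; exact: Ot.
  - by move=> y _; exact: Of.
apply: cconv_eq cG; first exact: cran_open.
- by apply: filterS Ofs => t Ot y _ /=; rewrite (scompE _ tG).
- by move=> y _ /=; rewrite (scompE _ tG).
Qed.

Lemma cvg_scomp_quotient O G fs f a (tau : T -> R) : open O -> deriv_tower O G ->
  (forall x, O (f x)) -> fs @ F --> f ->
  (tau t)^-1 *: (fs t - f) @[t --> F] --> a ->
  (tau t)^-1 *: (scomp (G 0) (fs t) - scomp (G 0) f) @[t --> F] -->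
    smul (scomp (G 1) f) a.
Proof.
move=> oO tG Of cf; have Ofs := cvg_near_open oO cf Of.
move=> /cvg_smoothP cq; apply/cvg_smoothP => c ac; move/(_ c ac) : cq => cq.
move/cvg_smoothP/(_ c ac) : cf => cf.
have tG1 : deriv_tower O (fun k => G k.+1) by move=> k x Ox; exact: tG.
apply: cconv_eq (cconv_comp_quotient (tau := tau) oO tG FF _ _ _ _ _ _ _ _ cf cq);
  try exact: cran_open.
- apply: filterS Ofs => t Ot y _.
  by rewrite /comp sscaleE saddE soppE !(scompE _ tG).
- by move=> y _ /=; rewrite smulE (scompE _ tG1).
- by move=> t; exact: smooth_on_chart.
- exact: smooth_on_chart.
- by move=> t; exact: smooth_on_chart.
- exact: smooth_on_chart.
- by apply: filterS Ofs => t Ot y _; exact: Ot.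
- by move=> y _; exact: Of.
- by [].
Qed.

End Convergence.

Lemma smoothfun_continuous f : continuous (f : M -> R).
Proof.
(* The identity along the neighbourhood filter of [f] is used as the convergent family, and the
   function argument is then frozen at [f]. *)
move=> x; have := @cvg_near_eval _ _ (nbhs_filter f) _ f x (@cvg_id _ _).
move=> cf P /cf[[A B] /= [fA xB] AB]; apply: filterS xB => y By.
by apply: (AB (f, y)); split=> //; exact: nbhs_singleton.
Qed.

End SmoothOperations.

(** * Integration of smooth functions *)

Section SmoothIntegration.
Context {R : realType} {n : nat} {M : manifold R n}.
Variable mu : {finite_measure set (borel M) -> \bar R}.
Implicit Types (f g : smoothfun M).

Definition sint f : R := \int[mu]_x f x.

Lemma smoothfun_measurable f : measurable_fun [set: borel M] (f : borel M -> R).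
Proof.
apply: (measurability _ (measurable_realfun.RGenOpens.measurableE R)).
move=> _ [_ [a [b ->] <-]]; rewrite setTI; apply: sub_sigma_algebra.
by apply: (continuousP _).1; [exact: smoothfun_continuous|exact: interval_open].
Qed.

Hypothesis Mcompact : compact [set: M].

Lemma smoothfun_bounded f : [bounded f x | x in [set: M]].
Proof.
have [C [Cr fC]] : bounded_set (f @` [set: M]).
  apply/compact_bounded/continuous_compact => //.
  by apply: continuous_subspaceT => x; exact: smoothfun_continuous.
by exists C; split=> // e Ce x _; apply: fC Ce _ _; exists x.
Qed.

Lemma smoothfun_integrable f : mu.-integrable [set: borel M] (EFin \o f).
Proof.
apply: measurable_bounded_integrable => //.
- by rewrite ltey_eq fin_num_measure.
- exact: smoothfun_measurable.
- exact: smoothfun_bounded.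
Qed.

Lemma eq_sint f g : (forall x, f x = g x) -> sint f = sint g.
Proof. by move=> fg; apply: eq_Rintegral => x _; exact: fg. Qed.

Lemma sintD f g : sint (f + g) = sint f + sint g.
Proof. by apply: RintegralD => //; exact: smoothfun_integrable. Qed.

Lemma sintZ (a : R) f : sint (a *: f) = a * sint f.
Proof. by apply: RintegralZl => //; exact: smoothfun_integrable. Qed.

Lemma sintN f : sint (- f) = - sint f.
Proof. by rewrite -scaleN1r sintZ mulN1r. Qed.

Lemma sintB f g : sint (f - g) = sint f - sint g.
Proof. by rewrite sintD sintN. Qed.

Lemma sint0 : sint 0 = 0.
Proof. by rewrite -(subrr (0 : smoothfun M)) sintB subrr. Qed.

Lemma sint_norm_le f (e : R) : (forall x, `|f x| <= e) ->
  `|sint f| <= e * fine (mu [set: borel M]).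
Proof.
move=> fe; rewrite -Rintegral_cst//.
apply: le_trans (le_normr_Rintegral _ _) _ => //; first exact: smoothfun_integrable.
apply: le_Rintegral => //.
- have /integrable_abse := smoothfun_integrable f; exact.
- apply: measurable_bounded_integrable => //.
  + by rewrite ltey_eq fin_num_measure.
  + exact: bounded_cst.
Qed.

Lemma cvg_sint {T : Type} (F : set_system T) {FF : Filter F}
    (fs : T -> smoothfun M) f : fs @ F --> f -> sint (fs t) @[t --> F] --> sint f.
Proof.
move=> cf; apply/cvgrPdist_lt => e e0.
have m0 : 0 <= fine (mu [set: borel M]) by rewrite fine_ge0.
(* The added 1 keeps the denominator positive even for a measure of total mass 0. *)
have d0 : 0 < e / (fine (mu [set: borel M]) + 1) by rewrite divr_gt0// ltr_wpDl.
have U := cvg_uniform Mcompact cf d0; near=> t.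
have ft x : `|f x - fs t x| < e / (fine (mu [set: borel M]) + 1).
  by move: x; near: t; exact: U.
have := sint_norm_le (f := f - fs t) (fun x => ltW (ft x)).
rewrite sintB => /le_lt_trans; apply.
by rewrite mulrAC ltr_pdivrMr ?ltr_pM2l// ?ltrDl// ltr_wpDl.
Unshelve. all: by end_near. Qed.

End SmoothIntegration.

(** * Rules for directional derivatives *)

Section DirectionalDerivatives.
Context {R : realType} {n : nat} {M : manifold R n}.
Variable mu : {finite_measure set (borel M) -> \bar R}.
Hypothesis Mcompact : compact [set: M].
Variable E : preTopologicalLmodType R.
Implicit Types (f g : E -> smoothfun M) (p u : E) (a b h : smoothfun M).

(** Continuity along the line, from f (p + t u) = t * quotient + f p; the product and composition
    rules need no more. *)
Lemma dirderiv_cvg f p u a : is_dirderiv f p u a ->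
  f (p + t *: u) @[t --> (0 : R)^'] --> f p.
Proof.
move=> da; have cid : (fun t : R => t) @ (0 : R)^' --> (0 : R).
  by apply: cvg_within_filter; exact: cvg_id.
have c0 : t *: (t^-1 *: (f (p + t *: u) - f p)) + f p @[t --> (0 : R)^'] -->
    (0 : R) *: a + f p.
  by apply: cvg_sadd; [exact: cvg_sscale cid da|exact: cvg_cst].
rewrite scale0r add0r in c0; apply: cvg_trans c0; apply: near_eq_cvg.
near=> t; have t0 : t != 0 by near: t; exact: nbhs_dnbhs_neq.
by rewrite scalerA mulfV// scale1r subrK.
Unshelve. all: by end_near. Qed.

Lemma dirderiv_cst h p u : is_dirderiv (fun=> h) p u 0.
Proof.
rewrite /is_dirderiv; under eq_fun do rewrite subrr scaler0.
exact: cvg_cst.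
Qed.

Lemma dirderiv_lin (L : E -> smoothfun M) p u :
  (forall (t : R) v w, L (t *: v + w) = t *: L v + L w) -> is_dirderiv L p u (L u).
Proof.
move=> linL.
have cL : L u @[t --> (0 : R)^'] --> L u by exact: cvg_cst.
apply: cvg_trans cL; apply: near_eq_cvg; near=> t.
have t0 : t != 0 by near: t; exact: nbhs_dnbhs_neq.
by rewrite [p + _]addrC linL addrK scalerA mulVf// scale1r.
Unshelve. all: by end_near. Qed.

Lemma dirderiv_add f g p u a b : is_dirderiv f p u a -> is_dirderiv g p u b ->
  is_dirderiv (fun q => f q + g q) p u (a + b).
Proof.
move=> da db; apply: cvg_trans (cvg_sadd da db); apply: near_eq_cvg.
by apply: nearW => t; rewrite -scalerDr addrACA -opprD.
Qed.

Lemma dirderiv_mul f g p u a b : is_dirderiv f p u a -> is_dirderiv g p u b ->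
  is_dirderiv (fun q => smul (f q) (g q)) p u (smul a (g p) + smul (f p) b).
Proof.
move=> da db.
have cf : f p @[t --> (0 : R)^'] --> f p by exact: cvg_cst.
apply: cvg_trans (cvg_sadd (cvg_smul da (dirderiv_cvg db)) (cvg_smul cf db)).
apply: near_eq_cvg; apply: nearW => t; apply: smoothfunE => x.
by rewrite !(saddE, sscaleE, soppE, smulE); ring.
Qed.

Lemma dirderiv_comp O F f p u a : open O -> deriv_tower O F ->
  (forall x, O (f p x)) -> is_dirderiv f p u a ->
  is_dirderiv (fun q => scomp (F 0) (f q)) p u (smul (scomp (F 1) (f p)) a).
Proof.
move=> oO tF Of da.
exact: (cvg_scomp_quotient Mcompact (tau := id) oO tF Of (dirderiv_cvg da) da).
Qed.

(** Integrals are turned into constant functions so that they stay among maps into [smoothfun M],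
    and division by an integral becomes a pointwise product. *)
Lemma dirderiv_int f p u a : is_dirderiv f p u a ->
  is_dirderiv (fun q => scst M (sint mu (f q))) p u (scst M (sint mu a)).
Proof.
move=> da.
have ci : sint mu (t^-1 *: (f (p + t *: u) - f p)) @[t --> (0 : R)^'] --> sint mu a.
  exact: cvg_sint da.
have cs : scst M (sint mu (t^-1 *: (f (p + t *: u) - f p))) @[t --> (0 : R)^'] -->
    scst M (sint mu a) by exact: cvg_scst ci.
apply: cvg_trans cs.
apply: near_eq_cvg; apply: nearW => t; apply: smoothfunE => x.
by rewrite sintZ// sintB// sscaleE saddE soppE !scstE.
Qed.



End DirectionalDerivatives.

Lemma is_dirderiv_eq (R : realType) (E F : preTopologicalLmodType R)
    (f : E -> F) p u a b : is_dirderiv f p u a -> a = b -> is_dirderiv f p u b.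
Proof. by move=> + <-. Qed.

(** * A class of maps closed under differentiation *)

Section SmoothCalculus.
Context {R : realType} {n : nat} {M : manifold R n}.
Variable mu : {finite_measure set (borel M) -> \bar R}.
Hypothesis Mcompact : compact [set: M].

(* Each constructor has a derivative rule that stays in the class, so all these
   maps are of class C^k for every k (calc_class_C). *)
Inductive calc (E : preTopologicalLmodType R) (U : set E) :
    (E -> smoothfun M) -> Prop :=
| calc_cst h : calc U (fun=> h)
| calc_lin L : (forall (t : R) v w, L (t *: v + w) = t *: L v + L w) ->
    continuous L -> calc U L
| calc_add f g : calc U f -> calc U g -> calc U (fun p => f p + g p)
| calc_mul f g : calc U f -> calc U g -> calc U (fun p => smul (f p) (g p))
| calc_comp O F f : open O -> deriv_tower O F -> calc U f ->
    (forall p, U p -> forall x, O (f p x)) -> calc U (fun p => scomp (F 0) (f p))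
| calc_int f : calc U f -> calc U (fun p => scst M (sint mu (f p))).

Lemma calc_continuous (E : preTopologicalLmodType R) (U : set E) f :
  calc U f -> {within U, continuous f}.
Proof.
move=> cf; apply/subspace_continuousP => p Up.
elim: cf => [h|L _ cL|f1 g1 _ IHf _ IHg|f1 g1 _ IHf _ IHg
  |O F f1 oO tF _ IHf Of|f1 _ IHf].
- exact: cvg_cst.
- by apply: cvg_within_filter; exact: cL.
- exact: cvg_sadd.
- exact: cvg_smul.
- by apply: (cvg_scomp Mcompact oO tF IHf); exact: Of.
- by apply: cvg_scst; exact: cvg_sint.
Qed.

(** Needed for the undifferentiated factors of the product and chain rules: in a differential at
    [(p, u)] they depend on [p] alone. *)
Lemma calc_fst (E E' : preTopologicalLmodType R) (U : set E) (T : set E') f :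
  calc U f -> @calc (E * E')%type (U `*` T) (f \o fst).
Proof.
elim=> [h|L lL cL|f1 g1 _ IHf _ IHg|f1 g1 _ IHf _ IHg|O F f1 oO tF _ IHf Of|f1 _ IHf].
- exact: calc_cst.
- apply: calc_lin => [t v w|v]; first exact: lL.
  exact: (@cvg_comp _ _ _ fst L (nbhs v) (nbhs v.1) _ cvg_fst (cL v.1)).
- exact: (calc_add IHf IHg).
- exact: (calc_mul IHf IHg).
- by apply: (calc_comp oO tF IHf) => -[p v] [Up _]; exact: Of.
- exact: (calc_int IHf).
Qed.

Lemma calc_differentiable (E : preTopologicalLmodType R) (T U : set E) f :
  calc U f -> exists2 df : E * E -> smoothfun M,
    @calc (E * E)%type (U `*` T) df &
    forall p u, U p -> T u -> is_dirderiv f p u (df (p, u)).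
Proof.
elim=> [h|L lL cL|f1 g1 cf [df cdf IHf] cg [dg cdg IHg]
  |f1 g1 cf [df cdf IHf] cg [dg cdg IHg]
  |O F f1 oO tF cf [df cdf IHf] Of|f1 cf [df cdf IHf]].
- by exists (fun=> 0); [exact: calc_cst|move=> p u _ _; exact: dirderiv_cst].
- exists (L \o snd); last by move=> p u _ _; exact: dirderiv_lin.
  apply: calc_lin => [t v w|v]; first exact: lL.
  exact: (@cvg_comp _ _ _ snd L (nbhs v) (nbhs v.2) _ cvg_snd (cL v.2)).
- exists (fun q => df q + dg q); first exact: calc_add.
  by move=> p u Up Tu; apply: dirderiv_add; [exact: IHf|exact: IHg].
- exists (fun q => smul (df q) (g1 q.1) + smul (f1 q.1) (dg q)).
    apply: calc_add; apply: calc_mul => //.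
    + exact: (calc_fst T cg).
    + exact: (calc_fst T cf).
  by move=> p u Up Tu; apply: dirderiv_mul; [exact: IHf|exact: IHg].
- exists (fun q => smul (scomp (F 1) (f1 q.1)) (df q)).
    apply: calc_mul => //.
    have tF1 : deriv_tower O (fun k => F k.+1) by move=> k x Ox; exact: tF.
    by apply: (calc_comp oO tF1 (calc_fst T cf)) => -[p v] [Up _]; exact: Of.
  move=> p u Up Tu; apply: (dirderiv_comp Mcompact oO tF); first exact: Of.
  exact: IHf.
- exists (fun q => scst M (sint mu (df q))); first exact: calc_int.
  by move=> p u Up Tu; apply: dirderiv_int => //; exact: IHf.
Qed.

Lemma is_dirderiv_pair (E : preTopologicalLmodType R) (f1 f2 : E -> smoothfun M)
    p u a1 a2 : is_dirderiv f1 p u a1 -> is_dirderiv f2 p u a2 ->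
  is_dirderiv (fun q => (f1 q, f2 q) : csmoothfun M) p u (a1, a2).
Proof. by move=> d1 d2; exact: (cvg_pair d1 d2). Qed.

(** The space and both sets are generalized in the induction because the differential lives on
    [E * E], over [U * T]. *)
Lemma calc_class_C k : forall (E : preTopologicalLmodType R) (T U : set E) f1 f2,
  calc U f1 -> calc U f2 ->
  class_C k T U (fun p => (f1 p, f2 p) : csmoothfun M).
Proof.
elim: k => [|k IHk] E T U f1 f2 c1 c2 /=.
  apply/subspace_continuousP => p Up.
  have /subspace_continuousP/(_ p Up) k1 := calc_continuous c1.
  have /subspace_continuousP/(_ p Up) k2 := calc_continuous c2.
  exact: (cvg_pair k1 k2).
split.
  apply/subspace_continuousP => p Up.
  have /subspace_continuousP/(_ p Up) k1 := calc_continuous c1.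
  have /subspace_continuousP/(_ p Up) k2 := calc_continuous c2.
  exact: (cvg_pair k1 k2).
have [df1 cd1 d1] := calc_differentiable T c1.
have [df2 cd2 d2] := calc_differentiable T c2.
exists (fun q => (df1 q, df2 q)); split; last exact: IHk.
by move=> p u Up Tu; apply: is_dirderiv_pair; [exact: d1|exact: d2].
Qed.

Lemma is_dirderiv_near (E F : preTopologicalLmodType R) (U : set E) (f g : E -> F)
    p u a : U p -> (\forall t \near (0 : R)^', U (p + t *: u)) ->
  (forall q, U q -> f q = g q) -> is_dirderiv f p u a -> is_dirderiv g p u a.
Proof.
move=> Up nU fg; apply: cvg_trans; apply: near_eq_cvg.
by apply: filterS nU => t Ut; rewrite !fg.
Qed.

(** Directions in [T] keep nearby points of the line inside [U], so both maps have the same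
    difference quotients there. The differential of [f] then serves for [g] unchanged, and no
    induction on [k] is needed. *)
Lemma class_C_eq k (E F : preTopologicalLmodType R) (T U : set E) (f g : E -> F) :
  (forall p u, U p -> T u -> \forall t \near (0 : R)^', U (p + t *: u)) ->
  (forall q, U q -> f q = g q) -> class_C k T U f -> class_C k T U g.
Proof.
move=> nU fg.
have C : {within U, continuous f} -> {within U, continuous g}.
  by move=> cf; apply: subspace_eq_continuous cf => q /set_mem; exact: fg.
case: k => [|k] /=; first exact: C.
move=> [/C cg [df [dfE cdf]]]; split=> //; exists df; split=> // p u Up Tu.
by apply: is_dirderiv_near (nU _ _ Up Tu) fg _ => //; exact: dfE.
Qed.

End SmoothCalculus.

(** * Derivatives of inverse, square root, cosine, sine and arctangent *)

Section ElementaryTowers.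
Context {R : realType}.
Implicit Types (k m : nat) (x : R).

Lemma is_derive_exprV m x : x != 0 ->
  is_derive x 1 (fun y : R => y^-1 ^+ m) (- (m%:R * x^-1 ^+ m.+1)).
Proof.
move=> x0; elim: m => [|m IH].
  by rewrite mul0r oppr0; exact: is_derive_cst.
have dV := is_deriveV x0 (@is_derive_id R R x 1).
have E : (fun y : R => y^-1 ^+ m.+1) = (fun y => y^-1) * (fun y => y^-1 ^+ m).
  by apply/funext => y; rewrite exprS.
rewrite E; apply: is_derive_eq (is_deriveM dV IH) _.
by rewrite /GRing.scale /= !exprS -natr1; field.
Qed.

Definition inv_tower k x : R := (-1) ^+ k * k`!%:R * x^-1 ^+ k.+1.

Lemma inv_towerP : deriv_tower [set x | x != 0] inv_tower.
Proof.
move=> k x x0; have := @is_deriveZ _ _ _ _ ((-1) ^+ k * k`!%:R) x 1 _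
  (is_derive_exprV k.+1 x0).
move=> D; apply: is_derive_eq D _.
by rewrite /inv_tower /GRing.scale /= factS natrM !exprS; ring.
Qed.

Lemma inv_tower0 x : inv_tower 0 x = x^-1.
Proof. by rewrite /inv_tower expr0 fact0 !mul1r expr1. Qed.

Lemma inv_tower1 x : inv_tower 1 x = - x^-1 ^+ 2.
Proof. by rewrite /inv_tower expr1 mulr1 mulN1r. Qed.

(** The product is the falling factorial of 1/2, and the power of exponent 1/2 - k is written as
    sqrt x times x^-k. *)
Definition sqrt_tower k x : R :=
  (\prod_(i < k) (2^-1 - i%:R)) * (Num.sqrt x * x^-1 ^+ k).

Lemma sqrt_towerP : deriv_tower [set x | 0 < x] sqrt_tower.
Proof.
move=> k x x0; have x1 : x != 0 by rewrite gt_eqF.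
have s0 : Num.sqrt x != 0 by rewrite gt_eqF// sqrtr_gt0.
have D := @is_deriveZ _ _ _ _ (\prod_(i < k) (2^-1 - i%:R) : R) x 1 _
  (is_deriveM (is_derive1_sqrt x0) (is_derive_exprV k x1)).
apply: is_derive_eq D _; rewrite /sqrt_tower /GRing.scale /= big_ord_recr /=.
(* Once [x] is replaced by the square of s, the identity is rational in s. *)
have xE : x = Num.sqrt x * Num.sqrt x by rewrite -expr2 sqr_sqrtr// ltW.
set s := Num.sqrt x in s0 xE *; rewrite !exprS; set y := x^-1 ^+ k.
by rewrite xE; field.
Qed.

Lemma sqrt_tower0 x : sqrt_tower 0 x = Num.sqrt x.
Proof. by rewrite /sqrt_tower big_ord0 mul1r expr0 mulr1. Qed.

Lemma sqrt_tower1 x : sqrt_tower 1 x = 2^-1 * (Num.sqrt x * x^-1).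
Proof. by rewrite /sqrt_tower big_ord_recl big_ord0 mulr1 subr0 expr1. Qed.

(** Each derivative is a shift by a quarter period, which avoids cases on [k] modulo 4. *)
Definition cos_tower k x : R := cos (x + (pi / 2) *+ k).
Definition sin_tower k x : R := sin (x + (pi / 2) *+ k).

Lemma cos_towerP : deriv_tower setT cos_tower.
Proof.
move=> k x _; have D := is_derive1_comp (is_derive_cos _)
  (is_derive_shift x 1 ((pi / 2) *+ k)).
apply: is_derive_eq D _; rewrite mulr1 /cos_tower [_ *+ k.+1]mulrSr addrA cosDpihalf.
by rewrite /= addrC.
Qed.

Lemma sin_towerP : deriv_tower setT sin_tower.
Proof.
move=> k x _; have D := is_derive1_comp (is_derive_sin _)
  (is_derive_shift x 1 ((pi / 2) *+ k)).
apply: is_derive_eq D _; rewrite mulr1 /sin_tower [_ *+ k.+1]mulrSr addrA sinDpihalf.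
by rewrite /= addrC.
Qed.

Lemma cos_tower0 x : cos_tower 0 x = cos x.
Proof. by rewrite /cos_tower mulr0n addr0. Qed.

Lemma sin_tower0 x : sin_tower 0 x = sin x.
Proof. by rewrite /sin_tower mulr0n addr0. Qed.

Lemma cos_tower1 x : cos_tower 1 x = - sin x.
Proof. by rewrite /cos_tower mulr1n cosDpihalf. Qed.

Lemma sin_tower1 x : sin_tower 1 x = cos x.
Proof. by rewrite /sin_tower mulr1n sinDpihalf. Qed.

(* The (k+1)-st derivative of atan is atan_num k / (1 + x^2)^(k+1). *)
Fixpoint atan_num k : {poly R} :=
  if k is k'.+1
  then (atan_num k')^`() * (1 + 'X^2) - (2 * k%:R) *: ('X * atan_num k')
  else 1.

Definition atan_tower k x : R :=
  if k is k'.+1 then (atan_num k').[x] * (1 + x ^+ 2)^-1 ^+ k'.+1 else atan x.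

Lemma atan_towerP : deriv_tower setT atan_tower.
Proof.
move=> [|k] x _.
  apply: is_derive_eq (is_derive1_atan x) _.
  by rewrite /atan_tower /= hornerC mul1r expr1.
have x0 : 1 + x ^+ 2 != 0 by rewrite gt_eqF// ltr_wpDr// sqr_ge0.
have dsq : is_derive x 1 (fun y : R => 1 + y ^+ 2) (2 * x).
  have D := is_derive_poly (1 + 'X^2 : {poly R}) x.
  have E : horner (1 + 'X^2 : {poly R}) = (fun y => 1 + y ^+ 2).
    by apply/funext => y; rewrite !hornerE.
  rewrite E in D; apply: is_derive_eq D _.
  by rewrite derivD derivC derivXn !hornerE /= mulr_natl.
have D := is_deriveM (is_derive_poly (atan_num k) x)
  (@is_derive1_comp _ (fun y => y^-1 ^+ k.+1) (fun y => 1 + y ^+ 2) x _ _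
    (is_derive_exprV k.+1 x0) dsq).
apply: is_derive_eq D _; rewrite /atan_tower /= [in LHS]/GRing.scale /=.
rewrite !(hornerD, hornerN, hornerZ, hornerM, hornerXn, hornerX, hornerC).
rewrite [RHS]mulrC (exprS _ k.+1); set y := _^-1 ^+ k.+1.
by field.
Qed.

End ElementaryTowers.


(** * Complex-valued smooth functions *)

Section ComplexFunctions.
Context {R : realType} {n : nat} {M : manifold R n}.
Implicit Types (f g h : csmoothfun M) (z w : R[i]).

Definition cmul f g : csmoothfun M :=
  (smul f.1 g.1 - smul f.2 g.2, smul f.1 g.2 + smul f.2 g.1).
Definition cconj f : csmoothfun M := (f.1, - f.2).

Lemma csmoothE f g : (forall x, cval f x = cval g x) -> f = g.
Proof.
case: f g => [f1 f2] [g1 g2] fg; congr pair; apply: smoothfunE => x.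
  by have [] := fg x.
by have [] := fg x.
Qed.

Lemma cvalD f g x : cval (f + g) x = cval f x + cval g x.
Proof. by []. Qed.

Lemma cvalN f x : cval (- f) x = - cval f x.
Proof. by []. Qed.

Lemma cvalZ z f x : cval (cscale z f) x = z * cval f x.
Proof. case: z => a b; rewrite -[LHS]/((a * f.1 x - b * f.2 x) +i*
  (b * f.1 x + a * f.2 x)).
by rewrite [b * _ + _]addrC. Qed.

Lemma cvalM f g x : cval (cmul f g) x = cval f x * cval g x.
Proof.
by rewrite -[LHS]/((smul f.1 g.1 x - smul f.2 g.2 x) +i*
  (smul f.1 g.2 x + smul f.2 g.1 x)) !smulE.
Qed.

Lemma cvalJ f x : cval (cconj f) x = conjc (cval f x).
Proof. by []. Qed.

End ComplexFunctions.

Section ConjugationMorphism.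
Context {R : realType}.
Implicit Types z w : R[i].

Lemma conjcM z w : conjc (z * w) = conjc z * conjc w.
Proof. exact: rmorphM. Qed.

Lemma conjcD z w : conjc (z + w) = conjc z + conjc w.
Proof. exact: rmorphD. Qed.

End ConjugationMorphism.

(** * The Hermitian product and the affine charts *)

Section HermitianProduct.
Context {R : realType} {n : nat} {M : manifold R n}.
Variable mu : {finite_measure set (borel M) -> \bar R}.
Hypothesis Mcompact : compact [set: M].
Implicit Types (f g h psi chi : csmoothfun M) (z w : R[i]).

Definition cint f : R[i] := sint mu f.1 +i* sint mu f.2.

Lemma cintD f g : cint (f + g) = cint f + cint g.
Proof. by apply/eqP; rewrite eq_complex /= !sintD// !eqxx. Qed.

Lemma cintZ z f : cint (cscale z f) = z * cint f.
Proof.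
case: z => a b; apply/eqP; rewrite eq_complex /= sintB// sintD// !sintZ//.
by rewrite [b * _ + _]addrC !eqxx.
Qed.

Lemma cintJ f : cint (cconj f) = conjc (cint f).
Proof. by apply/eqP; rewrite eq_complex /= sintN// !eqxx. Qed.

Lemma hermE f g : herm mu f g = cint (cmul f (cconj g)).
Proof.
rewrite /herm /cint /sint; congr (_ +i* _); apply: eq_Rintegral => x _.
  by rewrite -[in LHS]cvalJ -cvalM.
by rewrite -[in LHS]cvalJ -cvalM.
Qed.

Lemma hermDl f g h : herm mu (f + g) h = herm mu f h + herm mu g h.
Proof.
rewrite !hermE -cintD; congr cint; apply: csmoothE => x.
by rewrite cvalD !cvalM cvalD mulrDl.
Qed.

Lemma hermZl z f g : herm mu (cscale z f) g = z * herm mu f g.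
Proof.
rewrite !hermE -cintZ; congr cint; apply: csmoothE => x.
by rewrite cvalZ !cvalM cvalZ mulrA.
Qed.

Lemma hermC f g : herm mu g f = conjc (herm mu f g).
Proof.
rewrite !hermE -cintJ; congr cint; apply: csmoothE => x.
by rewrite !(cvalJ, cvalM) conjcM conjcK mulrC.
Qed.

Lemma hermDr f g h : herm mu f (g + h) = herm mu f g + herm mu f h.
Proof. by rewrite hermC hermDl conjcD -!hermC. Qed.

Lemma hermZr z f g : herm mu f (cscale z g) = conjc z * herm mu f g.
Proof. by rewrite hermC hermZl conjcM -hermC. Qed.

(** Both parts are written with integrals, sums, [smul] and [scst] only, the operations for which
    [calc] has rules; hence the sign as a factor [scst M (-1)]. *)
Lemma hermRI f g : herm mu f g =
  sint mu (smul f.1 g.1 + smul f.2 g.2) +i*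
  sint mu (smul f.2 g.1 + smul (scst M (-1)) (smul f.1 g.2)).
Proof.
rewrite hermE /cint; congr (_ +i* _); apply: eq_sint => x;
by rewrite !(saddE, soppE, smulE, scstE) /=; ring.
Qed.

Lemma complex_normsq_neq0 (a b : R) : a +i* b != 0 -> a * a + b * b != 0.
Proof.
apply: contra; rewrite paddr_eq0 -?expr2 ?sqr_ge0// !sqrf_eq0.
by rewrite eq_complex.
Qed.

Lemma complex_invE (a b : R) : a +i* b != 0 ->
  (a +i* b)^-1 = (a / (a * a + b * b)) +i* (- b / (a * a + b * b)).
Proof.
move=> ab; apply: (mulfI ab); rewrite mulfV//.
have N := complex_normsq_neq0 ab.
by apply/eqP; rewrite eq_complex /=; apply/andP; split; apply/eqP; field.
Qed.

(** With A + iB = <psi, chi>, this is (A - iB) psi / (A^2 + B^2), that is, psi / <psi, chi> spelled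
    out in real operations that [calc] can differentiate. *)
Definition affine_rep chi psi : csmoothfun M :=
  let A := scst M (sint mu (smul psi.1 chi.1 + smul psi.2 chi.2)) in
  let B := scst M (sint mu (smul psi.2 chi.1 +
                            smul (scst M (-1)) (smul psi.1 chi.2))) in
  let I := scomp (inv_tower 0) (smul A A + smul B B) in
  (smul I (smul A psi.1 + smul B psi.2),
   smul I (smul A psi.2 + smul B (smul (scst M (-1)) psi.1))).

Lemma affine_repE chi psi : herm mu psi chi != 0 ->
  affine_rep chi psi = cscale (herm mu psi chi)^-1 psi.
Proof.
rewrite hermRI; set A := sint _ _; set B := sint _ _ => h0.
have N := complex_normsq_neq0 h0.
have IE x : scomp (inv_tower 0) (smul (scst M A) (scst M A) +
    smul (scst M B) (scst M B)) x = (A * A + B * B)^-1.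
  rewrite (scompE _ (@inv_towerP R)) => [|y]; last first.
    by rewrite /mkset saddE !smulE !scstE.
  by rewrite inv_tower0 saddE !smulE !scstE.
apply: csmoothE => x; rewrite cvalZ complex_invE//.
apply/eqP; rewrite eq_complex; apply/andP; split; apply/eqP;
  rewrite /affine_rep /= -/A -/B smulE IE saddE !smulE !scstE; by field.
Qed.

(** Both components of [affine_rep] have this shape, with (a, b) equal to (psi.1, psi.2) and to
    (psi.2, - psi.1). *)
Lemma dirderiv_quotient (E : preTopologicalLmodType R)
    (A B a b : E -> smoothfun M) p u A' B' a' b' :
  (forall x, A p x * A p x + B p x * B p x != 0) ->
  is_dirderiv A p u A' -> is_dirderiv B p u B' ->
  is_dirderiv a p u a' -> is_dirderiv b p u b' ->
  exists2 D, is_dirderiv (fun q => smul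
      (scomp (inv_tower 0) (smul (A q) (A q) + smul (B q) (B q)))
      (smul (A q) (a q) + smul (B q) (b q))) p u D &
    forall x, let N := A p x * A p x + B p x * B p x in
      D x = (A' x * a p x + A p x * a' x + B' x * b p x + B p x * b' x) / N
        - 2 * (A p x * a p x + B p x * b p x)
          * (A p x * A' x + B p x * B' x) / (N * N).
Proof.
move=> N dA dB da db.
have dN := dirderiv_add (dirderiv_mul dA dA) (dirderiv_mul dB dB).
have oO : open [set x : R | x != 0] by exact: open_neq.
have NE x : [set y : R | y != 0] ((smul (A p) (A p) + smul (B p) (B p)) x).
  by rewrite /mkset saddE !smulE.
have dI := dirderiv_comp (f := fun q => smul (A q) (A q) + smul (B q) (B q))
  Mcompact oO (@inv_towerP R) NE dN.
have d1 := dirderiv_mul dI (dirderiv_add (dirderiv_mul dA da) (dirderiv_mul dB db)).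
eexists; first exact: d1.
have tV1 : deriv_tower [set y : R | y != 0] (fun k => inv_tower k.+1).
  by move=> k y y0; exact: inv_towerP.
move=> x; rewrite saddE !smulE (scompE _ tV1 NE) (scompE _ (@inv_towerP R) NE).
rewrite inv_tower0 inv_tower1 !(saddE, smulE) /=.
by have := N x => N0; field.
Qed.

(** The quotient rule for psi / <psi, chi>. The variation of the denominator contributes only a
    multiple of psi. *)
Lemma affine_rep_dirderiv (E : preTopologicalLmodType R)
    (a b : E -> smoothfun M) chi p u (beta : csmoothfun M) :
  let psi := (a p, b p) : csmoothfun M in let l := (herm mu psi chi)^-1 in
  herm mu psi chi != 0 ->
  is_dirderiv a p u beta.1 -> is_dirderiv b p u beta.2 ->
  is_dirderiv (fun q => affine_rep chi (a q, b q)) p u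
    (cscale l beta - cscale (l ^+ 2 * herm mu beta chi) psi).
Proof.
move=> psi l h0 da db.
have dc (h : smoothfun M) := dirderiv_cst h p u.
pose A (h1 h2 : smoothfun M) := scst M (sint mu (smul h1 chi.1 + smul h2 chi.2)).
pose B (h1 h2 : smoothfun M) :=
  scst M (sint mu (smul h2 chi.1 + smul (scst M (-1)) (smul h1 chi.2))).
have dA : is_dirderiv (fun q => A (a q) (b q)) p u (A beta.1 beta.2).
  apply: (is_dirderiv_eq (dirderiv_int (mu:=mu) Mcompact
    (dirderiv_add (dirderiv_mul da (dc chi.1)) (dirderiv_mul db (dc chi.2))))).
  congr (scst M _); apply: eq_sint => x.
  by rewrite !(saddE, smulE, s0E); ring.
have dB : is_dirderiv (fun q => B (a q) (b q)) p u (B beta.1 beta.2).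
  apply: (is_dirderiv_eq (dirderiv_int (mu:=mu) Mcompact
    (dirderiv_add (dirderiv_mul db (dc chi.1))
      (dirderiv_mul (dc (scst M (-1))) (dirderiv_mul da (dc chi.2)))))).
  congr (scst M _); apply: eq_sint => x.
  by rewrite !(saddE, smulE, s0E); ring.
have NE : forall x : M, A (a p) (b p) x * A (a p) (b p) x +
    B (a p) (b p) x * B (a p) (b p) x != 0.
  move=> x; rewrite /A /B !scstE; apply: complex_normsq_neq0.
  by move: h0; rewrite hermRI.
have [D1 d1 D1E] := dirderiv_quotient (A := fun q => A (a q) (b q))
  (B := fun q => B (a q) (b q)) NE dA dB da db.
have [D2 d2 D2E] := dirderiv_quotient (A := fun q => A (a q) (b q))
  (B := fun q => B (a q) (b q)) NE dA dB db
  (dirderiv_mul (dc (scst M (-1))) da).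
apply: (is_dirderiv_eq (is_dirderiv_pair d1 d2)).
apply: csmoothE => x; rewrite cvalD cvalN !cvalZ /l.
move: (D1E x) (D2E x) (NE x) h0; rewrite !hermRI.
rewrite !(saddE, smulE, s0E) /cval /A /B !scstE.
(* The integrals are the real and imaginary parts of <psi, chi> and <beta, chi>. With these as
   unknown reals, a rational identity at each point remains. *)
move: (sint _ _) (sint _ _) (sint _ _) (sint _ _) => A1 A0 B1 B0.
rewrite -[(D1, D2).1]/D1 -[(D1, D2).2]/D2 -[psi.1]/(a p) -[psi.2]/(b p).
move: (D1 x) (D2 x) (a p x) (b p x) (beta.1 x) (beta.2 x).
move=> e1 e2 a0 b0 a1 b1 -> -> N h0; rewrite complex_invE//.
by apply/eqP; rewrite eq_complex; apply/andP; split; apply/eqP;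
  rewrite expr2 /=; field.
Qed.

End HermitianProduct.

(** * The wave function of a density and a phase *)

Section Wave.
Context {R : realType} {n : nat} {M : manifold R n}.
Variable mu : {finite_measure set (borel M) -> \bar R}.
Hypothesis Mcompact : compact [set: M].
Implicit Types (p u : csmoothfun M) (chi psi : csmoothfun M).

(** Total on pairs of smooth functions, so that difference quotients can be formed in a vector
    space; positivity is left to the lemmas. *)
Definition wave p : csmoothfun M :=
  (smul (scomp (sqrt_tower 0) p.1) (scomp (cos_tower 0) (2^-1 *: p.2)),
   smul (scomp (sqrt_tower 0) p.1) (scomp (sin_tower 0) (2^-1 *: p.2))).

Definition positive p := forall x : M, 0 < p.1 x.

Lemma wave1E p x : positive p -> (wave p).1 x = Num.sqrt (p.1 x) * cos (p.2 x / 2).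
Proof.
move=> p0; rewrite smulE (scompE _ (@sqrt_towerP R) p0).
by rewrite (scompE _ (@cos_towerP R))// sqrt_tower0 cos_tower0 sscaleE [_ / 2]mulrC.
Qed.

Lemma wave2E p x : positive p -> (wave p).2 x = Num.sqrt (p.1 x) * sin (p.2 x / 2).
Proof.
move=> p0; rewrite smulE (scompE _ (@sqrt_towerP R) p0).
by rewrite (scompE _ (@sin_towerP R))// sqrt_tower0 sin_tower0 sscaleE [_ / 2]mulrC.
Qed.

Lemma cval_wave p x : positive p ->
  cval (wave p) x = (Num.sqrt (p.1 x))%:C * cis (p.2 x / 2).
Proof.
move=> p0; rewrite /cval wave1E// wave2E//.
by apply/eqP; rewrite eq_complex /= !mul0r subr0 addr0 !eqxx.
Qed.

(* psi (drho/rho + i dtheta) / 2 at psi = wave p. Multiplication by i is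
   madelung_J, which is why the Madelung transform is holomorphic. *)
Definition dwave p u : csmoothfun M :=
  cmul (wave p) (2^-1 *: smul u.1 (scomp (inv_tower 0) p.1), 2^-1 *: u.2).

Let halfsnd (q : csmoothfun M) : smoothfun M := 2^-1 *: q.2.

Let halfsnd_lin (t : R) (v w : csmoothfun M) :
  halfsnd (t *: v + w) = t *: halfsnd v + halfsnd w.
Proof.
apply: smoothfunE => x.
by rewrite /halfsnd !(saddE, sscaleE) mulrDr mulrCA.
Qed.

Let halfsnd_continuous : continuous halfsnd.
Proof. by move=> q; apply: cvg_sscale; [exact: cvg_cst|exact: cvg_snd]. Qed.

Lemma inv_scompE p x : positive p -> scomp (inv_tower 0) p.1 x = (p.1 x)^-1.
Proof.
move=> p0; rewrite (scompE _ (@inv_towerP R)) ?inv_tower0// => y.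
by rewrite /mkset gt_eqF.
Qed.

Let gt0_open : open [set x : R | 0 < x].
Proof. exact: open_gt. Qed.

(** The derivative of sqrt rho is sqrt rho / (2 rho) and the phase is theta / 2, so both variations
    share the factor psi / 2. *)
Lemma wave_dirderiv p u : positive p ->
  is_dirderiv (fun q => (wave q).1) p u (dwave p u).1 /\
  is_dirderiv (fun q => (wave q).2) p u (dwave p u).2.
Proof.
move=> p0.
have d1 : is_dirderiv (fun q : csmoothfun M => q.1) p u u.1.
  by apply: (dirderiv_lin (L := fst)).
have ds := dirderiv_comp (f := fst) Mcompact gt0_open (@sqrt_towerP R) p0 d1.
have d2 : is_dirderiv halfsnd p u (halfsnd u) by exact: dirderiv_lin.
have dc := dirderiv_comp Mcompact openT (@cos_towerP R) (fun=> I) d2.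
have dn := dirderiv_comp Mcompact openT (@sin_towerP R) (fun=> I) d2.
have tS : deriv_tower [set x : R | 0 < x] (fun k => sqrt_tower k.+1).
  by move=> k x; exact: sqrt_towerP.
have tC : deriv_tower [set: R] (fun k => cos_tower k.+1).
  by move=> k x; exact: cos_towerP.
have tN : deriv_tower [set: R] (fun k => sin_tower k.+1).
  by move=> k x; exact: sin_towerP.
split.
  apply: (is_dirderiv_eq (dirderiv_mul ds dc)); apply: smoothfunE => x.
  rewrite !(saddE, soppE, sscaleE, smulE) inv_scompE//.
  rewrite (scompE _ tS p0) (scompE _ tC)// !(scompE _ (@sqrt_towerP R) p0).
  rewrite !(scompE _ (@sin_towerP R))// !(scompE _ (@cos_towerP R))//.
  rewrite sqrt_tower0 sqrt_tower1 cos_tower0 cos_tower1 sin_tower0.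
  by rewrite /halfsnd !sscaleE; ring.
apply: (is_dirderiv_eq (dirderiv_mul ds dn)); apply: smoothfunE => x.
rewrite !(saddE, soppE, sscaleE, smulE) inv_scompE//.
rewrite (scompE _ tS p0) (scompE _ tN)// !(scompE _ (@sqrt_towerP R) p0).
rewrite !(scompE _ (@sin_towerP R))// !(scompE _ (@cos_towerP R))//.
rewrite sqrt_tower0 sqrt_tower1 cos_tower0 sin_tower1 sin_tower0.
by rewrite /halfsnd !sscaleE; ring.
Qed.

Lemma calc_wave (U : set (csmoothfun M)) : (forall p, U p -> positive p) ->
  calc mu U (fun p => (wave p).1) /\ calc mu U (fun p => (wave p).2).
Proof.
move=> Upos.
have c1 : calc mu U (fst : csmoothfun M -> smoothfun M).
  by apply: calc_lin => // q; exact: cvg_fst.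
have cs := calc_comp gt0_open (@sqrt_towerP R) c1 Upos.
have c2 : calc mu U halfsnd by exact: calc_lin.
have cc := calc_comp openT (@cos_towerP R) c2 (fun _ _ _ => I).
have cn := calc_comp openT (@sin_towerP R) c2 (fun _ _ _ => I).
by split; [exact: (calc_mul cs cc)|exact: (calc_mul cs cn)].
Qed.

Lemma calc_affine_rep (E : preTopologicalLmodType R) (U : set E)
    (a b : E -> smoothfun M) chi : calc mu U a -> calc mu U b ->
  (forall p : E, U p -> herm mu ((a p, b p) : csmoothfun M) chi != 0) ->
  calc mu U (fun p : E => (affine_rep mu chi (a p, b p)).1) /\
  calc mu U (fun p : E => (affine_rep mu chi (a p, b p)).2).
Proof.
move=> ca cb N; have cc h := calc_cst mu U h.
have cA := calc_int (calc_add (calc_mul ca (cc chi.1)) (calc_mul cb (cc chi.2))).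
have cB := calc_int (calc_add (calc_mul cb (cc chi.1))
  (calc_mul (cc (scst M (-1))) (calc_mul ca (cc chi.2)))).
have oO : open [set x : R | x != 0] by exact: open_neq.
have cI := calc_comp oO (@inv_towerP R)
  (calc_add (calc_mul cA cA) (calc_mul cB cB)).
split.
  apply: (calc_mul (cI _) (calc_add (calc_mul cA ca) (calc_mul cB cb))).
  move=> p Up x; rewrite /mkset saddE !smulE !scstE; apply: complex_normsq_neq0.
  by have := N p Up; rewrite hermRI.
apply: (calc_mul (cI _) (calc_add (calc_mul cA cb)
  (calc_mul cB (calc_mul (cc (scst M (-1))) ca)))).
move=> p Up x; rewrite /mkset saddE !smulE !scstE; apply: complex_normsq_neq0.
by have := N p Up; rewrite hermRI.
Qed.

Lemma herm_wave p : positive p -> herm mu (wave p) (wave p) = (sint mu p.1)%:C.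
Proof.
move=> p0; rewrite hermRI; congr (_ +i* _).
  apply: eq_sint => x; rewrite saddE (smulE (wave p).1) (smulE (wave p).2).
  rewrite wave1E// wave2E// -!expr2 !exprMn sqr_sqrtr ?ltW//.
  by rewrite -mulrDr cos2Dsin2 mulr1.
rewrite -(sint0 mu Mcompact); apply: eq_sint => x.
by rewrite !(saddE, smulE, scstE, s0E); ring.
Qed.

End Wave.

(** * The transform on the quotients and its smoothness *)

Section MadelungTransform.
Context {R : realType} {n : nat} {M : manifold R n}.
Variable mu : {finite_measure set (borel M) -> \bar R}.
Hypothesis Mcompact : compact [set: M].
Implicit Types (p u v chi : csmoothfun M) (rho : density mu) (theta : smoothfun M).

Lemma cis_neq0 (a : R) : cis a != 0.
Proof.
apply/eqP => a0; have /eqP := cisD a (- a).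
by rewrite a0 mul0r subrr cis0 oner_eq0.
Qed.

Lemma conjc_cis (a : R) : conjc (cis a) = cis (- a).
Proof. by rewrite /cis cosN sinN. Qed.

Lemma density_gt0 rho x : 0 < val rho x.
Proof. by have /asboolP[] := valP rho. Qed.

Lemma density_sint rho : sint mu (val rho) = 1.
Proof. by have /asboolP[] := valP rho. Qed.

Lemma wave_norm rho theta :
  herm mu (wave (val rho, theta)) (wave (val rho, theta)) = 1.
Proof.
by rewrite herm_wave//= ?density_sint// => x; exact: density_gt0.
Qed.

Definition wave_sphere rho theta : sphere mu :=
  exist _ (wave (val rho, theta)) (asboolT (wave_norm rho theta)) : sphere_sub mu.

Definition madelung (q : cotangent_dens mu) : projective mu :=
  \pi_(projective mu) (wave_sphere q.1 (repr q.2)).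

(** A constant c added to theta multiplies the wave function by the global phase of angle c / 2,
    which projective space forgets. *)
Lemma madelungE rho theta : madelung (rho, \pi_(@smooth_mod_const R n M) theta) =
  \pi_(projective mu) (wave_sphere rho theta).
Proof.
have : repr (\pi_(@smooth_mod_const R n M) theta) == theta
    %[mod @smooth_mod_const R n M].
  by rewrite reprK.
rewrite eqmodE => /asboolP[c E]; apply/projectiveP; exists (c / 2) => x.
have pos (h : smoothfun M) : positive (val rho, h) by move=> y; exact: density_gt0.
rewrite !cval_wave//= E mulrDl [_ / 2 + _]addrC cisD.
by rewrite mulrCA.
Qed.

Lemma is_madelung_madelung : is_madelung madelung.
Proof.
move=> rho theta; exists (wave_sphere rho theta); split; last exact: madelungE.
by move=> x; rewrite cval_wave// => y; exact: density_gt0.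
Qed.

Lemma repr_projective (psi : sphere mu) : exists a : R,
  (repr (\pi_(projective mu) psi) : csmoothfun M) = cscale (cis a) psi.
Proof.
have [a E] := (projectiveP (repr (\pi_(projective mu) psi)) psi).1 (reprK _).
by exists a; apply: csmoothE => x; rewrite cvalZ.
Qed.

Lemma affine_domE chi (psi : sphere mu) :
  affine_dom chi (\pi_(projective mu) psi) <-> herm mu psi chi != 0.
Proof.
rewrite /affine_dom /=; have [a ->] := repr_projective psi.
by rewrite hermZl// mulf_eq0 (negbTE (cis_neq0 a)).
Qed.

Lemma affine_chartE chi (psi : sphere mu) :
  affine_chart chi (\pi_(projective mu) psi) = cscale (herm mu psi chi)^-1 psi.
Proof.
rewrite /affine_chart; lazy zeta; have [a ->] := repr_projective psi.
apply: csmoothE => x; rewrite !cvalZ hermZl// invfM.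
by have c0 := cis_neq0 a; rewrite mulrCA !mulrA mulfV// mul1r.
Qed.

Lemma local_domP chi p : local_dom madelung chi p <->
  exists2 rho : density mu, p.1 = val rho & herm mu (wave p) chi != 0.
Proof.
case: p => p1 p2; split=> -[rho p1E h].
  have E : (p1, p2) = (val rho, p2) :> csmoothfun M by congr pair.
  exists rho; first exact: p1E.
  rewrite E; rewrite madelungE in h.
  exact: ((affine_domE chi (wave_sphere rho p2)).1 h).
have E : (p1, p2) = (val rho, p2) :> csmoothfun M by congr pair.
exists rho; first exact: p1E.
rewrite madelungE; rewrite E in h.
exact: ((affine_domE chi (wave_sphere rho p2)).2 h).
Qed.

Lemma local_dom_positive chi p : local_dom madelung chi p -> positive p.
Proof. by move=> /local_domP[rho pE _] x; rewrite pE; exact: density_gt0. Qed.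

Lemma local_dom_sint chi p : local_dom madelung chi p -> sint mu p.1 = 1.
Proof. by move=> /local_domP[rho -> _]; exact: density_sint. Qed.

Lemma local_dom_herm chi p : local_dom madelung chi p -> herm mu (wave p) chi != 0.
Proof. by move=> /local_domP[]. Qed.

Lemma local_domI chi p : positive p -> sint mu p.1 = 1 ->
  herm mu (wave p) chi != 0 -> local_dom madelung chi p.
Proof.
move=> p0 p1 h; apply/local_domP.
by exists (exist _ p.1 (asboolT (conj p0 p1)) : density mu).
Qed.

Lemma local_repE chi p : local_dom madelung chi p ->
  local_rep madelung chi p = cscale (herm mu (wave p) chi)^-1 (wave p).
Proof.
case: p => p1 p2 /local_domP[rho p1E h]; rewrite [p1]p1E.
rewrite /local_rep -[(val rho, p2).1]/(val rho) valK -[(val rho, p2).2]/p2.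
by rewrite madelungE affine_chartE.
Qed.

Lemma local_rep_affine chi p : local_dom madelung chi p ->
  local_rep madelung chi p = affine_rep mu chi ((wave p).1, (wave p).2).
Proof.
by move=> dp; rewrite local_repE// -affine_repE//; exact: local_dom_herm dp.
Qed.

(** Non-vanishing is tested on the squared modulus, a polynomial in two real integrals that
    converge. *)
Lemma near_herm_neq0 {T : Type} (F : set_system T) {FF : Filter F}
    (fs : T -> csmoothfun M) f chi :
  (fs t).1 @[t --> F] --> f.1 -> (fs t).2 @[t --> F] --> f.2 ->
  herm mu f chi != 0 -> \forall t \near F, herm mu (fs t) chi != 0.
Proof.
move=> c1 c2; rewrite hermRI => h0.
have cc (h : smoothfun M) : h @[t --> F] --> h by exact: cvg_cst.
pose A (h : csmoothfun M) := sint mu (smul h.1 chi.1 + smul h.2 chi.2).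
pose B (h : csmoothfun M) :=
  sint mu (smul h.2 chi.1 + smul (scst M (-1)) (smul h.1 chi.2)).
have cA : A (fs t) @[t --> F] --> A f.
  by apply: cvg_sint => //; apply: cvg_sadd; apply: cvg_smul.
have cB : B (fs t) @[t --> F] --> B f.
  by apply: cvg_sint => //; apply: cvg_sadd; apply: cvg_smul => //; apply: cvg_smul.
have N0 : A f * A f + B f * B f != 0 by exact: complex_normsq_neq0 h0.
have cN : A (fs t) * A (fs t) + B (fs t) * B (fs t) @[t --> F] -->
    A f * A f + B f * B f by apply: cvgD; apply: cvgM.
have nN : \forall t \near F, A (fs t) * A (fs t) + B (fs t) * B (fs t) != 0.
  exact: (cN [set y | y != 0] (open_nbhs_nbhs (conj (@open_neq _ 0) N0))).
near=> t; rewrite hermRI -/(A (fs t)) -/(B (fs t)).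
have Nt : A (fs t) * A (fs t) + B (fs t) * B (fs t) != 0 by near: t.
apply: contra Nt; rewrite eq_complex => /andP[/= /eqP -> /eqP ->].
by rewrite mulr0 addr0.
Unshelve. all: by end_near. Qed.

(** The condition on [u] preserves the total mass exactly; positivity and <psi, chi> != 0 are open
    conditions and persist for small t. *)
Lemma near_local_dom chi p u : local_dom madelung chi p -> sint mu u.1 = 0 ->
  \forall t \near (0 : R)^', local_dom madelung chi (p + t *: u).
Proof.
move=> dp u1; have p0 := local_dom_positive dp.
have d1 : is_dirderiv (fun q : csmoothfun M => q.1) p u u.1.
  by apply: (dirderiv_lin (L := fst)).
have oO : open [set x : R | 0 < x] by exact: open_gt.
have c1 := cvg_near_open Mcompact oO (dirderiv_cvg d1) p0.
have [dw1 dw2] := wave_dirderiv Mcompact u p0.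
have h0 := local_dom_herm dp.
have cw1 := dirderiv_cvg dw1; have cw2 := dirderiv_cvg dw2.
have nh := near_herm_neq0 (fs := fun t : R => wave (p + t *: u)) cw1 cw2 h0.
near=> t; apply: local_domI.
- by near: t; exact: c1.
- by rewrite /= sintD// sintZ// u1 mulr0 addr0 (local_dom_sint dp).
- by near: t; exact: nh.
Unshelve. all: by end_near. Qed.

Lemma smooth_madelung : smooth_map madelung.
Proof.
move=> chi k.
have [cw1 cw2] := calc_wave mu (U := local_dom madelung chi)
  (fun p => @local_dom_positive chi p).
have [c1 c2] := calc_affine_rep (chi := chi) cw1 cw2
  (fun p dp => local_dom_herm dp).
have := calc_class_C Mcompact k [set u | sint mu u.1 = 0] c1 c2.
apply: class_C_eq => [p u|q dq]; first exact: near_local_dom.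
by rewrite local_rep_affine//; case: affine_rep.
Qed.

End MadelungTransform.

(** * Metric, symplectic form and complex structure *)

Section KaehlerIdentities.
Context {R : realType} {n : nat} {M : manifold R n}.
Variable mu : {finite_measure set (borel M) -> \bar R}.
Hypothesis Mcompact : compact [set: M].
Implicit Types (p u v chi psi beta : csmoothfun M) (l c : R[i]).
Local Notation Phi := (@madelung R n M mu Mcompact).

Lemma cvalE (f1 f2 : smoothfun M) x :
  cval ((f1, f2) : csmoothfun M) x = f1 x +i* f2 x.
Proof. by []. Qed.

Lemma cscaleN c psi : - cscale c psi = cscale (- c) psi.
Proof. by apply: csmoothE => x; rewrite cvalN !cvalZ mulNr. Qed.

(** Evaluation at a point is continuous with values in a Hausdorff space. This identifies the
    derivatives given in [kahler_morphism] with the computed ones. *)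
Lemma csmooth_cvg_unique {T : Type} (F : set_system T) {FF : ProperFilter F}
    (fs : T -> csmoothfun M) (f g : csmoothfun M) :
  fs @ F --> f -> fs @ F --> g -> f = g.
Proof.
have fst_cvg (h : csmoothfun M) : fs @ F --> h -> (fs t).1 @[t --> F] --> h.1.
  by move=> ch; exact: (@cvg_comp _ _ _ fs fst F (nbhs h) (nbhs h.1) ch cvg_fst).
have snd_cvg (h : csmoothfun M) : fs @ F --> h -> (fs t).2 @[t --> F] --> h.2.
  by move=> ch; exact: (@cvg_comp _ _ _ fs snd F (nbhs h) (nbhs h.2) ch cvg_snd).
move=> cf cg; apply: csmoothE => x; congr (_ +i* _).
  have c1 : (fs t).1 x @[t --> F] --> f.1 x by exact: cvg_eval (fst_cvg _ cf).
  have c2 : (fs t).1 x @[t --> F] --> g.1 x by exact: cvg_eval (fst_cvg _ cg).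
  exact: (cvg_unique (@Rhausdorff R) c1 c2).
have c1 : (fs t).2 x @[t --> F] --> f.2 x by exact: cvg_eval (snd_cvg _ cf).
have c2 : (fs t).2 x @[t --> F] --> g.2 x by exact: cvg_eval (snd_cvg _ cg).
exact: (cvg_unique (@Rhausdorff R) c1 c2).
Qed.

Lemma wave_normsq p x : positive p ->
  cval (wave p) x * conjc (cval (wave p) x) = (p.1 x)%:C.
Proof.
move=> p0; rewrite cval_wave// conjcM conjc_cis mulrACA -cisD subrr cis0 mulr1.
have -> : conjc (Num.sqrt (p.1 x))%:C = (Num.sqrt (p.1 x))%:C by rewrite /= oppr0.
by rewrite -rmorphM /= -expr2 sqr_sqrtr// ltW.
Qed.

(** Since |psi|^2 = rho, the integrand is (drho + i rho dtheta) / 2; its two parts integrate to 0 by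
    the two conditions in [tangent]. *)
Lemma herm_dwave_wave p u : positive p -> tangent mu p u ->
  herm mu (dwave p u) (wave p) = 0.
Proof.
move=> p0 [u1 u2]; rewrite hermE.
have -> : cmul (dwave p u) (cconj (wave p)) =
    (2^-1 *: u.1, 2^-1 *: smul u.2 p.1) :> csmoothfun M.
  apply: csmoothE => x; rewrite !cvalM cvalJ mulrAC wave_normsq//.
  have p1 : p.1 x != 0 by rewrite gt_eqF.
  rewrite !cvalE !(sscaleE, smulE) inv_scompE//.
  by apply/eqP; rewrite eq_complex; apply/andP; split; apply/eqP => /=; field.
rewrite /cint !sintZ//; apply/eqP; rewrite eq_complex /= [sint _ u.1]u1 mulr0 eqxx.
rewrite (_ : sint mu (smul u.2 p.1) = 0) ?mulr0 ?eqxx//.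
by rewrite -[RHS]u2; apply: eq_Rintegral => x _; rewrite smulE.
Qed.

(** Along a constant vector field [liouville] is affine in t, so each derivative is read off as a
    slope. *)
Lemma canonical_symplecticE p u v : canonical_symplectic mu p u v =
  sint mu (smul u.1 v.2) - sint mu (smul u.2 v.1).
Proof.
have dL w w' : derive1 (fun t : R => liouville mu (p + t *: w) w') 0 =
    sint mu (smul w.2 w'.1).
  have -> : (fun t : R => liouville mu (p + t *: w) w') =
      (fun t => sint mu (smul p.2 w'.1) + t * sint mu (smul w.2 w'.1)).
    apply/funext => t; rewrite -sintZ// -sintD//.
    by apply: eq_Rintegral => x _; rewrite !(saddE, sscaleE, smulE) /=; ring.
  rewrite derive1E.
  move: (sint _ _) (sint _ _) => D C.
  have -> : (fun t => C + t * D) = cst C + (D \*: id).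
    by apply/funext => t; rewrite mulrC.
  have H : is_derive (0 : R) (1 : R) (cst C + (D \*: id)) (0 + D *: 1).
    exact: is_deriveD.
  by case: H => _ ->; rewrite add0r [LHS]mulr1.
rewrite /canonical_symplectic !dL opprB; congr (_ - _).
by rewrite smulC.
Qed.

Lemma sint_smul2 p u v : positive p ->
  sint mu (smul (smul (smul u.1 (scomp (inv_tower 0) p.1))
    (smul v.1 (scomp (inv_tower 0) p.1)) + smul u.2 v.2) p.1) =
  \int[mu]_x (((u.1 x / p.1 x) * (v.1 x / p.1 x) + u.2 x * v.2 x) * p.1 x).
Proof.
move=> p0; apply: eq_Rintegral => x _.
by rewrite !(smulE, saddE) inv_scompE.
Qed.

(** The minus sign disappears in [fubini_study_form], since the real part of i h is minus the
    imaginary part of h. *)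
Lemma herm_dwave p u v : positive p ->
  herm mu (dwave p u) (dwave p v) =
  sasaki_fisher_rao mu p u v +i* (- (4^-1 * canonical_symplectic mu p u v)).
Proof.
move=> p0; rewrite hermE canonical_symplecticE /sasaki_fisher_rao -sint_smul2//.
rewrite -mulrN opprB -sintB// -!sintZ//.
have -> : cmul (dwave p u) (cconj (dwave p v)) =
  (4^-1 *: smul (smul (smul u.1 (scomp (inv_tower 0) p.1))
      (smul v.1 (scomp (inv_tower 0) p.1)) + smul u.2 v.2) p.1,
   4^-1 *: (smul u.2 v.1 - smul u.1 v.2)) :> csmoothfun M; last by [].
apply: csmoothE => x.
rewrite !cvalM cvalJ cvalM conjcM mulrACA wave_normsq//.
have p1 : p.1 x != 0 by rewrite gt_eqF.
rewrite !cvalE !(saddE, soppE, sscaleE, smulE) !inv_scompE//.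
by apply/eqP; rewrite eq_complex; apply/andP; split; apply/eqP => /=; field.
Qed.

Definition madelung_J p u : csmoothfun M :=
  (- smul p.1 u.2, smul u.1 (scomp (inv_tower 0) p.1)).

(** The two normalizations are exchanged: the mass of - rho dtheta is minus the rho-mean of dtheta,
    and the rho-mean of drho / rho is the mass of drho. *)
Lemma tangent_J p u : positive p -> tangent mu p u -> tangent mu p (madelung_J p u).
Proof.
move=> p0 [u1 u2]; split.
  rewrite -[LHS]/(sint mu (- smul p.1 u.2)) sintN// smulC.
  apply/eqP; rewrite oppr_eq0; apply/eqP.
  by rewrite -[RHS]u2; apply: eq_Rintegral => x _; rewrite smulE.
rewrite -[RHS]u1; apply: eq_Rintegral => x _.
by rewrite smulE inv_scompE// divfK// gt_eqF.
Qed.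

Lemma dwave_J p u : positive p ->
  dwave p (madelung_J p u) = cscale (0 +i* 1) (dwave p u).
Proof.
move=> p0; apply: csmoothE => x; rewrite cvalZ !cvalM mulrCA; congr (_ * _).
have p1 : p.1 x != 0 by rewrite gt_eqF.
rewrite -[(madelung_J p u).1]/(- smul p.1 u.2).
rewrite -[(madelung_J p u).2]/(smul u.1 (scomp (inv_tower 0) p.1)).
rewrite !cvalE !(saddE, soppE, sscaleE, smulE) !inv_scompE//.
by apply/eqP; rewrite eq_complex; apply/andP; split; apply/eqP => /=; field.
Qed.

Lemma compatible_madelung_J : compatible_complex_structure mu madelung_J.
Proof.
move=> rho theta p u tu; have p0 : positive p by move=> x; exact: density_gt0.
split; first exact: tangent_J.
  have E x : p.1 x != 0 by rewrite gt_eqF.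
  rewrite (_ : - u = (- u.1, - u.2))//; congr pair; apply: smoothfunE => x.
    by rewrite !(soppE, smulE) inv_scompE// mulrC divfK.
  by rewrite !(soppE, smulE) inv_scompE// mulNr mulrC mulKf.
move=> v _; rewrite canonical_symplecticE /sasaki_fisher_rao -sintB//.
congr (_ * _); apply: eq_Rintegral => x _.
have E : p.1 x != 0 by rewrite gt_eqF.
by rewrite !(saddE, soppE, smulE) inv_scompE//; field.
Qed.

Lemma local_rep_dirderiv chi p u : local_dom Phi chi p -> sint mu u.1 = 0 ->
  let l := (herm mu (wave p) chi)^-1 in
  is_dirderiv (local_rep Phi chi) p u
    (cscale l (dwave p u) + cscale (- (l ^+ 2 * herm mu (dwave p u) chi)) (wave p)).
Proof.
move=> dp u1 l; have p0 := local_dom_positive dp.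
have [dw1 dw2] := wave_dirderiv Mcompact u p0.
have := affine_rep_dirderiv Mcompact (a := fun q => (wave q).1)
  (b := fun q => (wave q).2) (local_dom_herm dp) dw1 dw2.
rewrite -[((wave p).1, (wave p).2)]/(wave p) cscaleN.
apply: (is_dirderiv_near dp (near_local_dom dp u1)) => q dq.
by rewrite local_rep_affine.
Qed.

(** The contributions of [c] and [c'] cancel between the two terms of the form, and the factor |l|^2
    cancels against <l psi, l psi>. *)
Lemma fubini_study_hermE psi beta beta' l c c' : l != 0 -> herm mu psi psi = 1 ->
  herm mu beta psi = 0 -> herm mu beta' psi = 0 ->
  fubini_study_herm mu (cscale l psi) (cscale l beta + cscale c psi)
    (cscale l beta' + cscale c' psi) = herm mu beta beta'.
Proof.
move=> l0 psi1 bpsi b'psi.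
have psib' : herm mu psi beta' = 0 by rewrite hermC// b'psi /= oppr0.
have l'0 : conjc l != 0.
  by apply: contra l0 => /eqP l0; rewrite -(conjcK l) l0 /= oppr0.
rewrite /fubini_study_herm !(hermDl, hermDr, hermZl, hermZr)//.
rewrite psi1 bpsi psib' !mulr0 !mulr1 !addr0 !add0r.
by field; rewrite l0 l'0.
Qed.

Lemma fubini_study_hermZ l psi beta beta' :
  fubini_study_herm mu psi (cscale l beta) beta' =
  l * fubini_study_herm mu psi beta beta'.
Proof. by rewrite /fubini_study_herm !hermZl//; ring. Qed.

Lemma kahler_madelung : kahler_morphism Phi.
Proof.
split; first exact: smooth_madelung.
exists madelung_J; first exact: compatible_madelung_J.
move=> chi p u v a b dp tu tv da db z.
have p0 := local_dom_positive dp.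
have aE := csmooth_cvg_unique da (local_rep_dirderiv dp tu.1).
have bE := csmooth_cvg_unique db (local_rep_dirderiv dp tv.1).
have zE : z = cscale (herm mu (wave p) chi)^-1 (wave p) by exact: local_repE.
have l0 : (herm mu (wave p) chi)^-1 != 0 by rewrite invr_eq0 (local_dom_herm dp).
have w1 : herm mu (wave p) (wave p) = 1 by rewrite herm_wave// (local_dom_sint dp).
have FS : fubini_study_herm mu z a b = herm mu (dwave p u) (dwave p v).
  rewrite zE aE bE fubini_study_hermE//; exact: herm_dwave_wave.
split.
- by rewrite /fubini_study FS herm_dwave.
- rewrite /fubini_study_form /fubini_study fubini_study_hermZ FS herm_dwave//=.
  by rewrite mul0r mul1r opprK add0r.
(* The differential in the chart is complex linear in [dwave p u], including its multiple of the
   wave, so [dwave_J] transfers multiplication by i to it. *)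
- have [J1 _] := tangent_J p0 tu.
  apply: (is_dirderiv_eq (local_rep_dirderiv dp J1)).
  rewrite aE; apply: csmoothE => x.
  by rewrite dwave_J// hermZl// !(cvalZ, cvalD); ring.
Qed.

End KaehlerIdentities.

(** * Openness of the range *)

Section OpenRange.
Context {R : realType} {n : nat} {M : manifold R n}.
Variable mu : {finite_measure set (borel M) -> \bar R}.
Hypothesis Mcompact : compact [set: M].

Lemma sin_atan (x : R) : sin (atan x) = x * (Num.sqrt (1 + x ^+ 2))^-1.
Proof.
have c0 : cos (atan x) != 0.
  by rewrite gt_eqF// cos_gt0_pihalf// atan_gtNpi2 atan_ltpi2.
by rewrite -cos_atan -{2}(atanK x) /tan divfK.
Qed.

(** On the right half-plane atan (b / a) is the principal argument, so a smooth phase is available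
    without choosing branches. *)
Lemma polar_atan (a b : R) : 0 < a ->
  (Num.sqrt (a ^+ 2 + b ^+ 2))%:C * cis (atan (b / a)) = a +i* b.
Proof.
move=> a0; have a1 : a != 0 by rewrite gt_eqF.
have s0 : 0 < 1 + (b / a) ^+ 2 by rewrite ltr_pwDl// sqr_ge0.
have -> : Num.sqrt (a ^+ 2 + b ^+ 2) = a * Num.sqrt (1 + (b / a) ^+ 2).
  rewrite -[X in X * _](ger0_norm (ltW a0)) -sqrtr_sqr -sqrtrM ?sqr_ge0//.
  by congr Num.sqrt; field.
have t0 : Num.sqrt (1 + (b / a) ^+ 2) != 0 by rewrite gt_eqF// sqrtr_gt0.
rewrite /cis cos_atan sin_atan; move: t0; move: (Num.sqrt _) => t t0.
by apply/eqP; rewrite eq_complex /=; apply/andP; split; apply/eqP; field;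
  rewrite a1 t0.
Qed.

Lemma sphere_val_cvg (psi : sphere mu) :
  @sphere_val R n M mu @ psi --> (psi : csmoothfun M).
Proof. exact: (@initial_continuous _ _ (val : sphere_sub mu -> csmoothfun M) psi). Qed.

(* If psi0 is the transform of (rho0, theta0) and w = psi conj(psi0) has positive
   real part, then psi is the transform of
   (|psi|^2, theta0 + 2 atan (Im w / Re w)). *)
Lemma madelung_range_near (psi0 psi : sphere mu) :
  range (@madelung R n M mu Mcompact) (\pi_(projective mu) psi0) ->
  (forall x, 0 < complex.Re (cval psi x * conjc (cval psi0 x))) ->
  range (@madelung R n M mu Mcompact) (\pi_(projective mu) psi).
Proof.
move=> [[rho0 th0] _]; rewrite -[th0]reprK madelungE => /projectiveP[al psi0E] W0.
set theta0 := repr th0 in psi0E.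
pose f1 := (psi : csmoothfun M).1; pose f2 := (psi : csmoothfun M).2.
pose g1 := (psi0 : csmoothfun M).1; pose g2 := (psi0 : csmoothfun M).2.
pose a := smul f1 g1 + smul f2 g2; pose b := smul f2 g1 - smul f1 g2.
have WE x : cval psi x * conjc (cval psi0 x) = a x +i* b x.
  rewrite -[cval psi x]/(f1 x +i* f2 x) -[cval psi0 x]/(g1 x +i* g2 x).
  rewrite /a /b !(saddE, soppE, smulE).
  by apply/eqP; rewrite eq_complex; apply/andP; split; apply/eqP => /=; ring.
have a0 x : 0 < a x by have := W0 x; rewrite WE.
pose r := smul f1 f1 + smul f2 f2.
(* A zero of psi would make the real part [a] vanish there. *)
have r0 x : 0 < r x.
  rewrite lt_neqAle; apply/andP; split; last first.
    by rewrite saddE !smulE addr_ge0// -expr2 sqr_ge0.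
  rewrite eq_sym; apply/eqP => rx; have := a0 x; rewrite ltNge => /negP; apply.
  move: rx; rewrite /r saddE !smulE => /eqP.
  rewrite paddr_eq0 -?expr2 ?sqr_ge0// !sqrf_eq0 => /andP[/eqP f10 /eqP f20].
  by rewrite /a saddE !smulE f10 f20 !mul0r addr0.
have r1 : sint mu r = 1.
  have /asboolP := valP (psi : sphere_sub mu).
  by rewrite hermRI => /eqP; rewrite eq_complex => /andP[/eqP + _].
pose rho : density mu := exist _ r (asboolT (conj r0 r1)).
pose s := smul b (scomp (inv_tower 0) a).
have sE x : s x = b x / a x.
  rewrite smulE (scompE _ (@inv_towerP R)) ?inv_tower0// => y.
  by rewrite /mkset gt_eqF.
pose theta := theta0 + 2 *: scomp (atan_tower 0) s.
exists (rho, \pi_(@smooth_mod_const R n M) theta) => //; rewrite madelungE.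
(* [psi0] equals its wave function only up to the phase [al]; the same phase serves for [psi], whose
   phase is measured relative to [psi0]. *)
apply/projectiveP; exists al => x.
have pr : positive (val rho, theta) by move=> y; exact: r0.
have pr0 : positive (val rho0, theta0) by move=> y; exact: density_gt0.
rewrite cval_wave//.
pose m := Num.sqrt (val rho0 x); pose e := cis (theta0 x / 2).
have m0 : m%:C != 0.
  by rewrite eq_complex /= eqxx andbT gt_eqF// sqrtr_gt0 density_gt0.
have me : m%:C * e = cis al * cval psi0 x by rewrite -psi0E cval_wave.
have g2E : g1 x * g1 x + g2 x * g2 x = val rho0 x.
  have := wave_normsq x pr0.
  rewrite psi0E conjcM mulrACA conjc_cis -cisD subrr cis0 mul1r => H.
  move: H; rewrite -[cval psi0 x]/(g1 x +i* g2 x) => -[<- _].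
  by rewrite mulrN opprK.
(* Multiplicativity of the modulus: |psi conj(psi0)| = |psi| |psi0|, with |psi0| = [m]. *)
have normE : Num.sqrt (a x ^+ 2 + b x ^+ 2) = Num.sqrt (r x) * m.
  rewrite -sqrtrM ?ltW// -g2E; congr Num.sqrt.
  by rewrite /a /b /r !(saddE, soppE, smulE); ring.
have psi0C : conjc (cval psi0 x) = cis al * (m%:C * conjc e).
  have -> : m%:C * conjc e = conjc (m%:C * e).
    by rewrite conjcM; congr (_ * _); rewrite /= oppr0.
  by rewrite me conjcM mulrA conjc_cis -cisD subrr cis0 mul1r.
have thE : cis (theta x / 2) = e * cis (atan (b x / a x)).
  rewrite -cisD /theta saddE sscaleE (scompE _ (@atan_towerP R))// sE /=.
  by congr cis; field.
rewrite -[(val rho, theta).2]/theta thE -[(val rho, theta).1]/r.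
have ee : conjc e * e = 1 by rewrite conjc_cis -cisD addNr cis0.
have := polar_atan (b x) (a0 x).
have CM : (Num.sqrt (r x) * m)%:C = (Num.sqrt (r x))%:C * m%:C by exact: rmorphM.
rewrite normE -WE psi0C CM => H.
apply: (mulfI m0).
transitivity ((Num.sqrt (r x))%:C * m%:C * cis (atan (b x / a x)) * e); first by ring.
rewrite H; transitivity (m%:C * (cis al * cval psi x) * (conjc e * e)); first by ring.
by rewrite ee mulr1.
Qed.

(** Openness in the quotient is openness of the preimage on the sphere. There Re (psi conj(psi0))
    tends to |psi0|^2 > 0 as psi tends to psi0, and compactness makes it positive on all of [M] at
    once. *)
Lemma open_madelung_range : open (range (@madelung R n M mu Mcompact)).
Proof.
suff : open (\pi_(projective mu) @^-1` range (@madelung R n M mu Mcompact)) by [].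
rewrite openE => psi0 psi0r; rewrite /interior.
have c1 : (sphere_val psi).1 @[psi --> psi0] --> (sphere_val psi0).1.
  apply: (@cvg_comp _ _ _ (@sphere_val R n M mu) fst (nbhs psi0)
    (nbhs (sphere_val psi0)) (nbhs (sphere_val psi0).1)); last exact: cvg_fst.
  exact: sphere_val_cvg.
have c2 : (sphere_val psi).2 @[psi --> psi0] --> (sphere_val psi0).2.
  apply: (@cvg_comp _ _ _ (@sphere_val R n M mu) snd (nbhs psi0)
    (nbhs (sphere_val psi0)) (nbhs (sphere_val psi0).2)); last exact: cvg_snd.
  exact: sphere_val_cvg.
have FF : Filter (nbhs psi0) by exact: nbhs_filter.
have cc (h : smoothfun M) : h @[_ --> psi0] --> h by exact: cvg_cst.
have cW : smul (sphere_val psi).1 (sphere_val psi0).1 +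
    smul (sphere_val psi).2 (sphere_val psi0).2 @[psi --> psi0] -->
    smul (sphere_val psi0).1 (sphere_val psi0).1 +
    smul (sphere_val psi0).2 (sphere_val psi0).2.
  by apply: cvg_sadd; apply: cvg_smul.
have oO : open [set x : R | 0 < x] by exact: open_gt.
(* Membership of [psi0] in the range gives |psi0|^2 = rho0, which is positive everywhere. *)
have W0 x : [set x : R | 0 < x] ((smul (sphere_val psi0).1 (sphere_val psi0).1 +
    smul (sphere_val psi0).2 (sphere_val psi0).2) x).
  case: psi0r => -[rho0 th0] _; rewrite -[th0]reprK madelungE => /projectiveP[al E].
  have pr0 : positive (val rho0, repr th0) by move=> y; exact: density_gt0.
  have := wave_normsq x pr0; rewrite [cval (wave _) x]E.
  rewrite conjcM mulrACA conjc_cis -cisD subrr cis0 mul1r.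
  rewrite -[cval (sphere_val psi0) x]/((sphere_val psi0).1 x +i*
    (sphere_val psi0).2 x) => -[+ _].
  by rewrite mulrN opprK /mkset saddE !smulE => ->; exact: density_gt0.
have nW := cvg_near_open Mcompact oO cW W0.
near=> psi; apply: (madelung_range_near psi0r) => x.
rewrite -[cval (sphere_val psi) x]/((sphere_val psi).1 x +i* (sphere_val psi).2 x).
rewrite -[cval (sphere_val psi0) x]/((sphere_val psi0).1 x +i*
  (sphere_val psi0).2 x) /=.
rewrite mulrN opprK -!smulE -saddE; move: x; near: psi; exact: nW.
Unshelve. all: by end_near. Qed.

End OpenRange.

Theorem theorem1p2 (R : realType) (n : nat) (M : manifold R n)
    (Mcompact : compact [set: M]) (g : riemannian_metric M)
    (mu : {finite_measure set (borel M) -> \bar R})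
    (mu_vol : is_riemannian_volume g mu) :
  exists Phi : cotangent_dens mu -> projective mu,
    [/\ is_madelung Phi, open (range Phi) & kahler_morphism Phi].
Proof.
exists (@madelung R n M mu Mcompact); split.
- exact: is_madelung_madelung.
- exact: open_madelung_range.
- exact: kahler_madelung.
Qed.
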